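(* Let $\Gamma(z)=Cz$ ($z\in\mathbb{C}^n$) for a matrix $C\in\mathcal{M}(n)$ with $\|C\|\le 1$ and let $U$ be a holomorphic function on $\mathbb{C}^n$ such that $C_{U,\Gamma}$ is bounded on $F_\psi^2$. Then $C_{U,\Gamma}$ is a co-isometry on $F_\psi^2$ if and only if $$U(z)=\frac{1}{\overline{U(0)}}\ \text{ and }\ |U(z)|=1\ \text{ for all } z\in\mathbb{C}^n,\quad\text{and } C \text{ is unitary}.$$
   Context: Let $n\ge 1$. On $\mathbb{C}^n$ write $\langle w,z\rangle=\sum_{j=1}^n w_j\overline{z_j}$ and $|w|^2=\langle w,w\rangle$. $\mathcal{M}(n)$ is the set of complex $n\times n$ matrices and $\|C\|$ is the operator norm of $C$ induced by $|\cdot|$. Weight: $\psi:[0,\infty)\to[0,\infty)$ is a $C^3$ function with $\psi'(y)>0$, $\psi''(y)\ge 0$, $\psi'''(y)\ge 0$ for all $y\ge 0$. Moreover there is a real number $l<\tfrac12$ such that, with $\phi(y)=y\psi'(y)$, $\phi''(y)=O\big(y^{-1/2}[\phi'(y)]^{1+l}\big)$ as $y\to\infty$; when $n>1$ it is also assumed that $\psi''(y)=O\big(y^{-1/2}[\psi'(y)]^{1+l}\big)$ as $y\to\infty$. Space: $F_\psi^2$ is the Hilbert space of holomorphic functions $g:\mathbb{C}^n\to\mathbb{C}$ with $\int_{\mathbb{C}^n}|g(z)|^2e^{-\psi(|z|^2)}\,d\mu(z)<\infty$, with inner product $\langle g,h\rangle_\psi=\int_{\mathbb{C}^n} g(z)\overline{h(z)}e^{-\psi(|z|^2)}\,d\mu(z)$,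 where $\mu$ is Lebesgue measure on $\mathbb{C}^n$. For holomorphic $U:\mathbb{C}^n\to\mathbb{C}$ and $\Gamma:\mathbb{C}^n\to\mathbb{C}^n$, the weighted composition operator is $C_{U,\Gamma}f=U\cdot(f\circ\Gamma)$. ''Bounded on $F_\psi^2$'' means that the operator maps $F_\psi^2$ into itself and is a bounded linear operator. A bounded operator $S$ on a Hilbert space $H$ is a co-isometry if $S^*$ is an isometry, equivalently $SS^*=I_H$. *)

(* Defs.v *)
From HB Require Import structures.
From mathcomp Require Import all_boot all_order all_algebra.
From mathcomp Require Import complex.
From mathcomp Require Import all_classical all_reals all_analysis.

Set Implicit Arguments.
Unset Strict Implicit.
Unset Printing Implicit Defensive.

Import Order.TTheory GRing.Theory Num.Theory.
Import numFieldNormedType.Exports.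
Import Normc.

Local Open Scope classical_set_scope.
Local Open Scope ring_scope.

(* Frechet differentiability with a K-linear differential; used at K := R[i].
   The topology on 'cV[K]_n is that of the sup norm. *)
Definition holomorphic (K : numFieldType) (n : nat) (g : 'cV[K]_n -> K) : Prop :=
  forall z, differentiable (g : 'cV[K]_n -> K^o) z.

Section Cn.
Context {R : realType} {n : nat}.
Implicit Types w z : 'cV[R[i]]_n.

Definition cdot w z : R[i] := \sum_(j < n) w j 0 * (z j 0)^*.

Definition sqnorm z : R := complex.Re (cdot z z).

Definition cnorm z : R := Num.sqrt (sqnorm z).

Definition opnorm (C : 'M[R[i]]_n) : R :=
  sup [set cnorm (C *m z) | z in [set z | cnorm z <= 1]].

End Cn.

(* The library's sigma-finiteness instance for \x is not found by inference:
   the instance keyed on product_measure1 is the subprobability one. *)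
Lemma sigma_finite_product d1 d2 (T1 : measurableType d1)
    (T2 : measurableType d2) (R : realType)
    (m1 : {sigma_finite_measure set T1 -> \bar R})
    (m2 : {sigma_finite_measure set T2 -> \bar R}) :
  sigma_finite setT (m1 \x m2)%E.
Proof.
have /sigma_finiteP[F [TF ndF Foo]] := sigma_finiteT m1.
have /sigma_finiteP[G [TG ndG Goo]] := sigma_finiteT m2.
exists (fun n => F n `*` G n).
  rewrite -setXTT TF TG predeqE => -[x y]; split.
    move=> [/= [n _ Fnx] [k _ Gky]]; exists (maxn n k) => //; split.
    - by move: x Fnx; exact/subsetPset/ndF/leq_maxl.
    - by move: y Gky; exact/subsetPset/ndG/leq_maxr.
  by move=> [n _ []/= ? ?]; split; exists n.
move=> k; have [? ?] := Foo k; have [? ?] := Goo k.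
split; first exact: measurableX.
by rewrite product_measure1E// lte_mul_pinfty// ge0_fin_numE.
Qed.

Section lebesgue_measure_Cn.
Context {R : realType}.
Local Notation M := (measurableTypeR R * measurableTypeR R)%type.

Definition lebesgue_C : set M -> \bar R :=
  (@lebesgue_measure R \x @lebesgue_measure R)%E.
HB.instance Definition _ := Measure.on lebesgue_C.
HB.instance Definition _ :=
  Measure_isSigmaFinite.Build _ _ _ lebesgue_C
    (sigma_finite_product (@lebesgue_measure R) (@lebesgue_measure R)).

Definition tcons n (p : M * n.-tuple M) : n.+1.-tuple M := [tuple of p.1 :: p.2].

Lemma measurable_tcons n : measurable_fun [set: M * n.-tuple M] (@tcons n).
Proof. exact: measurable_cons. Qed.

Definition tuncons n (t : n.+1.-tuple M) : M * n.-tuple M :=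
  (thead t, [tuple of behead t]).

Lemma measurable_tuncons n : measurable_fun setT (@tuncons n).
Proof.
apply/measurable_fun_pairP; split; last exact: measurable_behead.
exact: measurable_tnth.
Qed.

Lemma tconsK n : cancel (@tcons n) (@tuncons n).
Proof. by move=> [x t]; congr pair; apply: val_inj. Qed.

Lemma tunconsK n : cancel (@tuncons n) (@tcons n).
Proof. by move=> t; rewrite [RHS]tuple_eta; apply: val_inj. Qed.

Section step.
Variables (n : nat) (nu : {sigma_finite_measure set (n.-tuple M) -> \bar R}).

Definition lebesgue_step : set (n.+1.-tuple M) -> \bar R :=
  pushforward (lebesgue_C \x nu)%E (@tcons n).

Let step0 : lebesgue_step set0 = 0%E.
Proof. by apply: measure0; exact: measurable_tcons. Qed.

Let step_ge0 A : (0 <= lebesgue_step A)%E.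
Proof. by apply: measure_ge0; exact: measurable_tcons. Qed.

Let step_sigma_additive : semi_sigma_additive lebesgue_step.
Proof. by apply: measure_semi_sigma_additive; exact: measurable_tcons. Qed.

HB.instance Definition _ := isMeasure.Build _ _ _ lebesgue_step
  step0 step_ge0 step_sigma_additive.

Let step_sigma_finite : sigma_finite setT lebesgue_step.
Proof.
have [F TF Foo] := sigma_finite_product lebesgue_C nu.
exists (fun k => @tuncons n @^-1` F k).
  by rewrite -preimage_bigcup -TF.
move=> k; have [mF Fk] := Foo k; split.
  by rewrite -[X in measurable X]setTI; exact: measurable_tuncons.
rewrite /lebesgue_step /pushforward -comp_preimage.
by rewrite (_ : _ \o _ = id)//; apply/funext => x /=; exact: tconsK.
Qed.

HB.instance Definition _ := Measure_isSigmaFinite.Build _ _ _ lebesgue_step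
  step_sigma_finite.

End step.

(* C^n is identified with (R * R)^n through real and imaginary parts (toCn),
   and carries the n-fold product of the planar Lebesgue measure. *)
Fixpoint lebesgue_Cn (n : nat) :
    {sigma_finite_measure set (n.-tuple M) -> \bar R} :=
  match n with
  | 0 => \d_([tuple])
  | m.+1 => lebesgue_step (lebesgue_Cn m)
  end.

Lemma lebesgue_Cn_box n (A : 'I_n -> set M) : (forall j, measurable (A j)) ->
  lebesgue_Cn n [set t | forall j, A j (tnth t j)] =
  (\prod_(j < n) lebesgue_C (A j))%E.
Proof.
elim: n A => [A _|n IH A mA].
  by rewrite big_ord0 /= diracE mem_set//= => -[].
rewrite big_ord_recl -IH// -product_measure1E//.
  congr ((lebesgue_C \x lebesgue_Cn n)%E _); apply/seteqP; split => -[x t]/= xt.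
    by split=> [|j]; [have := xt ord0|have := xt (lift ord0 j)];
       rewrite ?tnth0 ?tnthS.
  move=> j; have [k ->|->] := unliftP ord0 j; first by rewrite tnthS; case: xt.
  by rewrite tnth0; case: xt.
rewrite (_ : [set _ | _] = \bigcap_(j in [set: 'I_n])
  ((fun t : n.-tuple M => tnth t j) @^-1` A (lift ord0 j))); last first.
  by apply/seteqP; split => t/= At j => [_|]; exact: At.
apply: fin_bigcap_measurable => // j _.
by rewrite -[X in measurable X]setTI; exact: measurable_tnth.
Qed.

Definition toCn n (t : n.-tuple M) : 'cV[R[i]]_n :=
  \col_j ((tnth t j).1 +i* (tnth t j).2)%C.

Definition cintegral n (f : 'cV[R[i]]_n -> R[i]) : R[i] :=
  ((\int[lebesgue_Cn n]_t complex.Re (f (toCn t))) +i*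
   (\int[lebesgue_Cn n]_t complex.Im (f (toCn t))))%C.

End lebesgue_measure_Cn.

Section half_line_calculus.
Context {R : realType}.
Implicit Types f : R -> R.

(* Derivatives of functions on [0, +oo[, one-sided at 0. *)
Definition hquotient f (y : R) : set_system R :=
  (f x - f y) / (x - y) @[x --> within [set x | 0 <= x] y^'].

Definition hderivable f : Prop :=
  forall y : R, 0 <= y -> cvg (hquotient f y).

Definition hderiv f (y : R) : R := lim (hquotient f y).

Definition hclass (k : nat) f : Prop :=
  (forall j, (j < k)%N -> hderivable (iter j hderiv f)) /\
  {within [set y | 0 <= y], continuous (iter k hderiv f)}.

End half_line_calculus.

Record admissible_weight (R : realType) (n : nat) (psi : R -> R) : Prop := {
  weight_ge0 : forall y : R, 0 <= y -> 0 <= psi y;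
  weight_C3 : hclass 3 psi;
  weight_deriv1 : forall y : R, 0 <= y -> 0 < hderiv psi y;
  weight_deriv2 : forall y : R, 0 <= y -> 0 <= hderiv (hderiv psi) y;
  weight_deriv3 : forall y : R, 0 <= y -> 0 <= hderiv (hderiv (hderiv psi)) y;
  weight_growth : exists2 l : R, l < 2^-1 &
    let phi := fun y => y * hderiv psi y in
    hderiv (hderiv phi) =O_ (FilterType +oo_R _)
      (fun y => y `^ (- 2^-1) * hderiv phi y `^ (1 + l)) /\
    ((1 < n)%N ->
     hderiv (hderiv psi) =O_ (FilterType +oo_R _)
      (fun y => y `^ (- 2^-1) * hderiv psi y `^ (1 + l)))
}.

Section fock_space.
Context {R : realType} {n : nat} (psi : R -> R).
Local Notation Cn := 'cV[R[i]]_n.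
Implicit Types (f g h : Cn -> R[i]) (S T : (Cn -> R[i]) -> (Cn -> R[i])).

Definition fock_weight (z : Cn) : R := expR (- psi (sqnorm z)).

Definition fock : set (Cn -> R[i]) :=
  [set g | holomorphic g /\
    (\int[lebesgue_Cn n]_t
       (normc (g (toCn t)) ^+ 2 * fock_weight (toCn t))%:E < +oo)%E].

Definition fock_inner g h : R[i] :=
  cintegral (fun z => g z * (h z)^* * (fock_weight z)%:C%C).

Definition fock_norm g : R := Num.sqrt (complex.Re (fock_inner g g)).

Definition bounded_operator S : Prop :=
  [/\ forall f, fock f -> fock (S f),
      forall (a : R[i]) f g, fock f -> fock g ->
        S (fun z => a * f z + g z) = (fun z => a * S f z + S g z) &
      exists B : R, forall f, fock f -> fock_norm (S f) <= B * fock_norm f].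

Definition is_adjoint S T : Prop :=
  bounded_operator T /\
  forall f g, fock f -> fock g -> fock_inner (S f) g = fock_inner f (T g).

Definition isometry T : Prop :=
  forall f, fock f -> fock_norm (T f) = fock_norm f.

(* The adjoint is unique when it exists: an element of fock of norm 0 is 0. *)
Definition coisometry S : Prop := exists2 T, is_adjoint S T & isometry T.

End fock_space.

Definition weighted_comp (R : realType) (n : nat) (U : 'cV[R[i]]_n -> R[i])
    (Gamma : 'cV[R[i]]_n -> 'cV[R[i]]_n) (f : 'cV[R[i]]_n -> R[i]) :
    'cV[R[i]]_n -> R[i] :=
  fun z => U z * f (Gamma z).

(* Main.v *)
Require Import Defs.
From mathcomp Require Import all_boot all_order all_algebra.
From mathcomp Require Import complex.
From mathcomp Require Import all_classical all_reals all_analysis.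
From mathcomp Require Import perm measurable_realfun ring lra.
Import Order.TTheory GRing.Theory Num.Theory.
Import numFieldNormedType.Exports.
Import Normc.
Local Open Scope ring_scope.

Set Implicit Arguments.
Unset Strict Implicit.
Unset Printing Implicit Defensive.

(** Write [S f = U * (f o C)] and let [T] be its adjoint.

    A unitary [C] preserves Lebesgue measure and the weight, so for a constant
    [U] of modulus one [S] is a unitary operator whose adjoint has the same
    shape, with [C] replaced by its adjoint ([unitary_coisometry]).

    Conversely, suppose that [T] is an isometry. The reproducing kernel at the
    origin is a constant: by the mean value property,
    [<f, 1> = f 0 * <1, 1>] ([mean_value]). Since
    [(S f) 0 = U 0 * f 0], this gives [T 1 = (U 0)^*], and isometry of [T] gives
    [`|U 0| = 1]. Next, [S T f = f]: expanding [|f - T S f|^2 >= 0] shows that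
    [S] is a contraction, whence [|S T f - f|^2 <= 0]. For [f = 1] this reads
    [U z * (U 0)^* = 1], so [U] is constant. Applied to the coordinate functions
    it also shows that [C] is injective; hence [T S f = f] too, and [S]
    preserves inner products. The coordinates are orthogonal with equal norms
    ([inner_coord], [inner_coord_diag]), so comparing the inner products of
    their images says that the rows of [C] are orthonormal.

    Three facts of analysis carry the argument.
    - Linear maps preserving the Euclidean norm preserve Lebesgue measure
      ([preserves_act]). This follows from translation invariance by computing
      one double integral against a Gaussian in two ways.
    - Entire functions have the mean value property on circles
      ([circle_mean]). Holomorphy is differentiability at each point, with no
      continuity of the derivative, so the core is Goursat's subdivision
      argument. It is run in logarithmic polar coordinates, where a circle is a
      vertical segment and periodicity cancels the horizontal sides.
    - Polynomials of degree one belong to the space ([integrable_polygauss]): the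
      weight is convex and increasing, so it grows at least linearly and
      [expR (- psi `|z|^2)] is dominated by a Gaussian. *)

(** * Goursat's theorem for closed pairs of real functions *)

Section GreenRectangle.
Variable R : realType.
Implicit Types (P Q : R -> R -> R) (f : R -> R) (a b c k e : R).
Local Notation mu := (@lebesgue_measure R).
Local Open Scope classical_set_scope.

Definition segint (a b : R) f : R := \int[mu]_(x in `[a, b]) f x.

Lemma segint_integrable a b f : continuous f ->
  mu.-integrable `[a, b] (EFin \o f).
Proof.
move=> cf; apply: continuous_compact_integrable; first exact: segment_compact.
by apply: continuous_subspaceT.
Qed.

Lemma segint_cat a c b f : continuous f -> a <= c -> c <= b ->
  segint a b f = segint a c f + segint c b f.
Proof.
move=> cf ac cb; rewrite /segint.
have := @Rintegral_itvB R f (BLeft a) (BRight b) c.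
rewrite !bnd_simp => /(_ (segint_integrable a b cf) ac cb) E.
rewrite -(@Rintegral_itv_obnd_cbnd R c (BRight b) f); first by rewrite -E; ring.
apply: (integrableS _ _ _ (segint_integrable c b cf)) => //.
exact: subset_itv_oc_cc.
Qed.

Lemma segintB a b f g : continuous f -> continuous g ->
  segint a b (fun x => f x - g x) = segint a b f - segint a b g.
Proof.
by move=> cf cg; rewrite /segint RintegralB//; exact: segint_integrable.
Qed.

Lemma segint_cst a b k : a <= b -> segint a b (fun=> k) = k * (b - a).
Proof.
move=> ab; rewrite /segint Rintegral_cst// [X in fine X]lebesgue_measure_itv/=.
case: ifPn => //; rewrite lte_fin -leNgt => ba.
have -> : a = b by apply/le_anti; rewrite ab ba.
by rewrite subrr mulr0.
Qed.

Lemma segint_near_cst a b f k e : a <= b -> continuous f ->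
  (forall x, a <= x <= b -> `|f x - k| <= e) ->
  `|segint a b f - k * (b - a)| <= e * (b - a).
Proof.
move=> ab cf fk; have ck (c : R) : continuous (fun _ : R => c : R) by exact: cst_continuous.
rewrite -(segint_cst k ab) -segintB//.
have ci : continuous (fun x => f x - k : R).
  by move=> x; apply: (@cvgB _ R^o); [exact: cf|exact: ck].
rewrite -(segint_cst e ab) /segint.
apply: (le_trans (le_normr_Rintegral _ (segint_integrable _ _ ci))) => //.
apply: le_Rintegral => //.
- apply: (@segint_integrable _ _ (fun x => `|f x - k|)) => x.
  by apply: (@cvg_norm _ _ _ _ _ (fun x => f x - k)); exact: ci.
- by apply: segint_integrable; exact: ck.
Qed.

(** The 1-form [P dx + Q dy] is closed at the point in the weakest sense: both
    functions are differentiable there, and the common coefficient [b] equates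
    the cross partial derivatives. *)
Definition closed_at P Q (x0 y0 : R) : Prop := exists a b c : R,
  forall e, 0 < e -> exists2 d, 0 < d & forall x y,
    `|x - x0| < d -> `|y - y0| < d ->
    `|P x y - P x0 y0 - (a * (x - x0) + b * (y - y0))|
       <= e * (`|x - x0| + `|y - y0|) /\
    `|Q x y - Q x0 y0 - (b * (x - x0) + c * (y - y0))|
       <= e * (`|x - x0| + `|y - y0|).

(** The integral of [P dx + Q dy] around the rectangle, opposite sides being
    grouped so that each integrand is a small difference. *)
Definition circulation P Q x1 x2 y1 y2 : R :=
  segint x1 x2 (fun x => P x y1 - P x y2) +
  segint y1 y2 (fun y => Q x2 y - Q x1 y).

Lemma small_affine_continuous f x0 a : (forall e, 0 < e -> exists2 d, 0 < d &
    forall x, `|x - x0| < d -> `|f x - f x0 - a * (x - x0)| <= e * `|x - x0|) ->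
  {for x0, continuous f}.
Proof.
move=> H; apply/cvgrPdist_lt => e e0.
have [d d0 Hd] := H 1 ltr01.
have k0 : 0 < `|a| + 1 by rewrite ltr_wpDl.
apply/nbhs_ballP; exists (Num.min d (e / (`|a| + 1))) => /=.
  by rewrite lt_min d0 divr_gt0.
move=> x; rewrite /ball/= distrC lt_min => /andP[/Hd xd].
rewrite ltr_pdivlMr// => xe; rewrite distrC.
rewrite mul1r in xd; apply: le_lt_trans xe; rewrite mulrDr mulr1.
have -> : f x - f x0 = (f x - f x0 - a * (x - x0)) + a * (x - x0) by ring.
apply: (le_trans (ler_normD _ _)); rewrite normrM addrC mulrC.
by rewrite lerD2l.
Qed.

Lemma closed_continuousl P Q : (forall x y, closed_at P Q x y) ->
  forall y, continuous (P ^~ y).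
Proof.
move=> H y x0; have [a [b [c K]]] := H x0 y.
apply: (@small_affine_continuous _ _ a) => e /K[d d0 Kd]; exists d => // x xd.
have := Kd x y xd; rewrite subrr normr0 => /(_ d0)[+ _].
by rewrite mulr0 !addr0.
Qed.

Lemma closed_continuousr P Q : (forall x y, closed_at P Q x y) ->
  forall x, continuous (Q x).
Proof.
move=> H x y0; have [a [b [c K]]] := H x y0.
apply: (@small_affine_continuous _ _ c) => e /K[d d0 Kd]; exists d => // y yd.
have := Kd x y; rewrite subrr normr0 => /(_ d0 yd)[_ +].
by rewrite mulr0 !add0r.
Qed.

Section closed.
Variables P Q : R -> R -> R.
Hypothesis PQ : forall x y, closed_at P Q x y.

Let cP y : continuous (P ^~ y). Proof. exact: closed_continuousl PQ y. Qed.
Let cQ x : continuous (Q x). Proof. exact: closed_continuousr PQ x. Qed.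

Let contB f g : continuous f -> continuous g -> continuous (fun x => f x - g x : R).
Proof. by move=> cf cg x; apply: cvgB; [exact: cf|exact: cg]. Qed.

Lemma circulation_split x1 xm x2 y1 ym y2 :
  x1 <= xm -> xm <= x2 -> y1 <= ym -> ym <= y2 ->
  circulation P Q x1 x2 y1 y2 =
  circulation P Q x1 xm y1 ym + circulation P Q xm x2 y1 ym +
  (circulation P Q x1 xm ym y2 + circulation P Q xm x2 ym y2).
Proof.
move=> h1 h2 h3 h4; rewrite /circulation.
rewrite !segintB// (@segint_cat x1 xm x2 (P ^~ y1))//.
rewrite (@segint_cat x1 xm x2 (P ^~ y2))//.
rewrite (@segint_cat y1 ym y2 (Q x2))// (@segint_cat y1 ym y2 (Q x1))//.
ring.
Qed.

(** On a small rectangle the affine parts of [P] and [Q] contribute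
    [- b * area] and [b * area], and cancel. *)
Lemma circulation_small x0 y0 e : 0 < e -> exists2 d, 0 < d &
  forall x1 y1 l k, 0 <= l < d -> 0 <= k < d -> x1 <= x0 <= x1 + l ->
    y1 <= y0 <= y1 + k ->
    `|circulation P Q x1 (x1 + l) y1 (y1 + k)| <= e * (l + k) ^+ 2.
Proof.
move=> e0; have [a [b [c K]]] := PQ x0 y0.
have [|d d0 Kd] := K (e / 2); first by rewrite divr_gt0.
exists d => // x1 y1 l k /andP[l0 ld] /andP[k0 kd] /andP[xl xr] /andP[yl yr].
have nearx x : x1 <= x <= x1 + l -> `|x - x0| <= l.
  by move=> /andP[u v]; rewrite ler_norml; apply/andP; split; lra.
have neary y : y1 <= y <= y1 + k -> `|y - y0| <= k.
  by move=> /andP[u v]; rewrite ler_norml; apply/andP; split; lra.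
have main x y : x1 <= x <= x1 + l -> y1 <= y <= y1 + k ->
    `|P x y - P x0 y0 - (a * (x - x0) + b * (y - y0))| <= e / 2 * (l + k) /\
    `|Q x y - Q x0 y0 - (b * (x - x0) + c * (y - y0))| <= e / 2 * (l + k).
  move=> /nearx hx /neary hy.
  have [p q] := Kd x y (le_lt_trans hx ld) (le_lt_trans hy kd).
  by split; [apply: (le_trans p)|apply: (le_trans q)];
    apply: ler_wpM2l; rewrite ?lerD// divr_ge0// ltW.
have y1in : y1 <= y1 <= y1 + k by rewrite lexx lerDl.
have y2in : y1 <= y1 + k <= y1 + k by rewrite lexx lerDl k0.
have x1in : x1 <= x1 <= x1 + l by rewrite lexx lerDl.
have x2in : x1 <= x1 + l <= x1 + l by rewrite lexx lerDl l0.
have I1 : `|segint x1 (x1 + l) (fun x => P x y1 - P x (y1 + k)) - (- b * k) * (x1 + l - x1)|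
    <= e * (l + k) * (x1 + l - x1).
  apply: segint_near_cst; [by rewrite lerDl|exact: contB|].
  move=> x hx; have [A _] := main _ _ hx y1in; have [B _] := main _ _ hx y2in.
  rewrite ler_norml in A; rewrite ler_norml in B; move: A B => /andP[? ?] /andP[? ?].
  by rewrite ler_norml; apply/andP; split; lra.
have I2 : `|segint y1 (y1 + k) (fun y => Q (x1 + l) y - Q x1 y) - (b * l) * (y1 + k - y1)|
    <= e * (l + k) * (y1 + k - y1).
  apply: segint_near_cst; [by rewrite lerDl|exact: contB|].
  move=> y hy; have [_ A] := main _ _ x1in hy; have [_ B] := main _ _ x2in hy.
  rewrite ler_norml in A; rewrite ler_norml in B; move: A B => /andP[? ?] /andP[? ?].
  by rewrite ler_norml; apply/andP; split; lra.
rewrite /circulation.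
have -> : forall u v : R, u + v =
    (u - (- b * k) * (x1 + l - x1)) + (v - (b * l) * (y1 + k - y1)).
  by move=> u v; ring.
apply: (le_trans (ler_normD _ _)); apply: (le_trans (lerD I1 I2)).
by rewrite le_eqVlt; apply/orP; left; apply/eqP; ring.
Qed.

(** Goursat's subdivision argument: among the four quarters of a rectangle one
    carries at least a quarter of the circulation, and the nested rectangles
    shrink to a point where [circulation_small] applies. *)
Lemma circulation_eq0 x1 y1 l k : 0 <= l -> 0 <= k ->
  circulation P Q x1 (x1 + l) y1 (y1 + k) = 0.
Proof.
move=> l0 k0; pose h n : R := 2^-1 ^+ n.
have h0 n : 0 <= h n by rewrite exprn_ge0// invr_ge0.
have hS n : h n = h n.+1 + h n.+1 by rewrite /h exprS; field.
pose W n (p : R * R) := circulation P Q p.1 (p.1 + l * h n) p.2 (p.2 + k * h n).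
have step n p : exists q : R * R, [/\ p.1 <= q.1, q.1 + l * h n.+1 <= p.1 + l * h n,
    p.2 <= q.2, q.2 + k * h n.+1 <= p.2 + k * h n & `|W n p| <= 4 * `|W n.+1 q|].
  apply: contrapT => H.
  pose ll := l * h n.+1; pose kk := k * h n.+1.
  have ll0 : 0 <= ll by rewrite mulr_ge0.
  have kk0 : 0 <= kk by rewrite mulr_ge0.
  have E1 : l * h n = ll + ll by rewrite hS mulrDr.
  have E2 : k * h n = kk + kk by rewrite hS mulrDr.
  have S : W n p = W n.+1 p + W n.+1 (p.1 + ll, p.2) +
      (W n.+1 (p.1, p.2 + kk) + W n.+1 (p.1 + ll, p.2 + kk)).
    rewrite /W/= E1 E2 -/ll -/kk (addrA p.1) (addrA p.2).
    by apply: circulation_split; rewrite ?lerDl.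
  have big q : (q.1 = p.1 \/ q.1 = p.1 + ll) -> (q.2 = p.2 \/ q.2 = p.2 + kk) ->
      4 * `|W n.+1 q| < `|W n p|.
    move=> q1 q2; rewrite ltNge; apply/negP => qW; apply: H; exists q.
    rewrite -/ll -/kk E1 E2.
    by case: q1 q2 => -> [] ->; split=> //; lra.
  have := big p (or_introl erefl) (or_introl erefl).
  have := big (p.1 + ll, p.2) (or_intror erefl) (or_introl erefl).
  have := big (p.1, p.2 + kk) (or_introl erefl) (or_intror erefl).
  have := big (p.1 + ll, p.2 + kk) (or_intror erefl) (or_intror erefl).
  have : `|W n p| <= `|W n.+1 p| + `|W n.+1 (p.1 + ll, p.2)| +
      (`|W n.+1 (p.1, p.2 + kk)| + `|W n.+1 (p.1 + ll, p.2 + kk)|).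
    rewrite S; apply: (le_trans (ler_normD _ _)).
    by apply: lerD; exact: ler_normD.
  lra.
have /choice[nxt Hnxt] : forall np : nat * (R * R), exists q : R * R,
    [/\ np.2.1 <= q.1, q.1 + l * h np.1.+1 <= np.2.1 + l * h np.1,
    np.2.2 <= q.2, q.2 + k * h np.1.+1 <= np.2.2 + k * h np.1 &
    `|W np.1 np.2| <= 4 * `|W np.1.+1 q|] by move=> [n p]; exact: step.
pose s := fix s n := if n is m.+1 then nxt (m, s m) else (x1, y1).
have sS n : s n.+1 = nxt (n, s n) by [].
have sW n : `|W 0%N (x1, y1)| <= 4 ^+ n * `|W n (s n)|.
  elim: n => [|n IH]; first by rewrite expr0 mul1r.
  apply: (le_trans IH); rewrite exprSr -mulrA ler_wpM2l ?exprn_ge0//.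
  by rewrite sS; have [] := Hnxt (n, s n).
have inc1 : nondecreasing_seq (fun n => (s n).1).
  by apply/nondecreasing_seqP => n; rewrite sS; have [] := Hnxt (n, s n).
have inc2 : nondecreasing_seq (fun n => (s n).2).
  by apply/nondecreasing_seqP => n; rewrite sS; have [] := Hnxt (n, s n).
have dec1 : nonincreasing_seq (fun n => (s n).1 + l * h n).
  by apply/nonincreasing_seqP => n; rewrite sS; have [] := Hnxt (n, s n).
have dec2 : nonincreasing_seq (fun n => (s n).2 + k * h n).
  by apply/nonincreasing_seqP => n; rewrite sS; have [] := Hnxt (n, s n).
have lim (u : nat -> R) c : 0 <= c -> nondecreasing_seq u ->
    nonincreasing_seq (fun n => u n + c * h n) ->
    exists x0, forall n, u n <= x0 <= u n + c * h n.
  move=> c0 ui ud; exists (sup (range u)) => n.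
  have ub m : u m <= u n + c * h n.
    have [nm|mn] := leqP n m.
      by apply: le_trans (ud _ _ nm); rewrite lerDl mulr_ge0.
    by apply: (le_trans (ui _ _ (ltnW mn))); rewrite lerDl mulr_ge0.
  apply/andP; split.
    by apply: ub_le_sup; [exists (u n + c * h n) => _ [m _ <-]|exists n].
  by apply: ge_sup; [exists (u 0%N); exists 0%N|move=> _ [m _ <-]].
have [x0 Hx] := lim _ _ l0 inc1 dec1.
have [y0 Hy] := lim _ _ k0 inc2 dec2.
have W0 : W 0%N (x1, y1) = circulation P Q x1 (x1 + l) y1 (y1 + k).
  by rewrite /W/h/= expr0 !mulr1.
rewrite -W0; apply/eqP; rewrite -normr_le0; apply/ler_addgt0Pr => e e0.
rewrite add0r.
have c0 : 0 < (l + k) ^+ 2 + 1 by rewrite ltr_wpDl// sqr_ge0.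
(* [n] halvings divide the circulation by at most [4 ^+ n] and the area by
   exactly that much, so any error proportional to the area suffices. *)
have [|d d0 Hd] := @circulation_small x0 y0 (e / ((l + k) ^+ 2 + 1)).
  by rewrite divr_gt0.
have hcvg : h n @[n --> \oo] --> (0 : R).
  by apply: cvg_expr; rewrite ger0_norm ?invr_ge0// invf_lt1// ltr1n.
have lk0 : 0 < l + k + 1 by rewrite ltr_wpDl// addr_ge0.
have [n hn] : exists n, h n < d / (l + k + 1).
  have /cvgrPdist_lt/(_ (d / (l + k + 1)) (divr_gt0 d0 lk0)) [N _ HN] := hcvg.
  exists N; have := HN N (leqnn N).
  by rewrite sub0r normrN ger0_norm.
rewrite ltr_pdivlMr// in hn.
apply: (le_trans (sW n)).
have lh0 : 0 <= l * h n by rewrite mulr_ge0.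
have kh0 : 0 <= k * h n by rewrite mulr_ge0.
have hh : h n * (l + k + 1) = l * h n + k * h n + h n by ring.
rewrite hh in hn; have hn0 := h0 n.
have := Hd (s n).1 (s n).2 (l * h n) (k * h n).
have -> : 0 <= l * h n < d by apply/andP; split => //; lra.
have -> : 0 <= k * h n < d by apply/andP; split => //; lra.
move=> /(_ isT isT (Hx n) (Hy n)) {}Hd.
apply: (le_trans (ler_wpM2l _ Hd)); first by rewrite exprn_ge0.
have -> : 4 ^+ n * (e / ((l + k) ^+ 2 + 1) * (l * h n + k * h n) ^+ 2) =
   e * ((l + k) ^+ 2 / ((l + k) ^+ 2 + 1)) * (4 ^+ n * h n ^+ 2) by ring.
have -> : 4 ^+ n * h n ^+ 2 = 1.
  rewrite /h -exprM mulnC exprM -exprMn.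
  have -> : 4 * 2^-1 ^+ 2 = 1 :> R by field.
  by rewrite expr1n.
rewrite mulr1 ler_piMr ?(ltW e0)// ler_pdivrMr// mul1r lerDl//.
Qed.

End closed.
End GreenRectangle.

(** * Measurability and coordinates on complex n-space *)

Section ComplexMeasurability.
Context d (X : measurableType d) (R : realType).
Implicit Types u v : X -> R[i].
Local Open Scope classical_set_scope.

Definition cmeasurable u : Prop :=
  measurable_fun setT (fun x => complex.Re (u x)) /\
  measurable_fun setT (fun x => complex.Im (u x)).

Lemma cmeasurable_cst (k : R[i]) : cmeasurable (fun=> k).
Proof. by split; exact: measurable_cst. Qed.

Lemma cmeasurableD u v : cmeasurable u -> cmeasurable v ->
  cmeasurable (fun x => u x + v x).
Proof.
move=> [u1 u2] [v1 v2]; split.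
  under eq_fun do rewrite raddfD/=; exact: measurable_funD.
under eq_fun do rewrite raddfD/=; exact: measurable_funD.
Qed.

Lemma cmeasurableM u v : cmeasurable u -> cmeasurable v ->
  cmeasurable (fun x => u x * v x).
Proof.
have ReM (x y : R[i]) : complex.Re (x * y) =
    complex.Re x * complex.Re y - complex.Im x * complex.Im y.
  by case: x => a b; case: y => a' b'.
have ImM (x y : R[i]) : complex.Im (x * y) =
    complex.Re x * complex.Im y + complex.Im x * complex.Re y.
  by case: x => a b; case: y => a' b'.
move=> [u1 u2] [v1 v2]; split.
  under eq_fun do rewrite ReM; apply: measurable_funB; exact: measurable_funM.
under eq_fun do rewrite ImM; apply: measurable_funD; exact: measurable_funM.
Qed.

Lemma cmeasurable_conj u : cmeasurable u -> cmeasurable (fun x => (u x)^*).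
Proof.
have ReC (x : R[i]) : complex.Re x^* = complex.Re x by case: x.
have ImC (x : R[i]) : complex.Im x^* = - complex.Im x by case: x.
move=> [u1 u2]; split; under eq_fun do rewrite ?ReC ?ImC; first exact: u1.
exact: measurableT_comp.
Qed.

Lemma cmeasurable_sum (I : Type) (s : seq I) (u : I -> X -> R[i]) :
  (forall i, cmeasurable (u i)) -> cmeasurable (fun x => \sum_(i <- s) u i x).
Proof.
move=> mu; elim: s => [|i s IH].
  by under eq_fun do rewrite big_nil; exact: cmeasurable_cst.
by under eq_fun do rewrite big_cons; exact: cmeasurableD.
Qed.

End ComplexMeasurability.

Section Coordinates.
Context {R : realType}.
Local Notation M := (measurableTypeR R * measurableTypeR R)%type.
Local Open Scope classical_set_scope.

Definition ofCn n (z : 'cV[R[i]]_n) : n.-tuple M :=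
  [tuple (complex.Re (z j 0), complex.Im (z j 0)) | j < n].

Lemma ofCnK n : cancel (@ofCn n) (@toCn R n).
Proof.
by move=> z; apply/colP => j; rewrite mxE tnth_mktuple/=; case: (z j 0).
Qed.

Lemma toCnK n : cancel (@toCn R n) (@ofCn n).
Proof.
move=> t; apply: eq_from_tnth => j; rewrite tnth_mktuple mxE/=.
by case: (tnth t j).
Qed.

Lemma measurable_ofCn d (X : measurableType d) n (u : X -> 'cV[R[i]]_n) :
  (forall j, cmeasurable (fun x => u x j 0)) -> measurable_fun setT (fun x => ofCn (u x)).
Proof.
move=> mu; apply/measurable_fun_tnthP => j; have [m1 m2] := mu j.
rewrite (_ : _ \o _ = fun x => (complex.Re (u x j 0), complex.Im (u x j 0))).
  exact: measurable_fun_pair.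
by apply/funext => x /=; rewrite tnth_mktuple.
Qed.

Lemma cmeasurable_toCn d (X : measurableType d) n (phi : X -> n.-tuple M) (j : 'I_n) :
  measurable_fun setT phi -> cmeasurable (fun x => toCn (phi x) j 0).
Proof.
move=> mphi; have mj : measurable_fun setT (fun x => tnth (phi x) j).
  by have /measurable_fun_tnthP/(_ j) := mphi.
by split; under eq_fun do rewrite mxE/=; exact: measurableT_comp.
Qed.

Lemma cmeasurable_mulmx d (X : measurableType d) m n (A : 'M[R[i]]_(m, n))
    (u : X -> 'cV[R[i]]_n) (j : 'I_m) :
  (forall j, cmeasurable (fun x => u x j 0)) -> cmeasurable (fun x => (A *m u x) j 0).
Proof.
move=> mu; under eq_fun do rewrite mxE.
by apply: cmeasurable_sum => k; apply: cmeasurableM => //; exact: cmeasurable_cst.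
Qed.

Definition actCn n (A : 'M[R[i]]_n) (t : n.-tuple M) : n.-tuple M :=
  ofCn (A *m toCn t).

Definition transCn n (s t : n.-tuple M) : n.-tuple M := ofCn (toCn t + toCn s).

Lemma toCn_act n (A : 'M[R[i]]_n) t : toCn (actCn A t) = A *m toCn t.
Proof. by rewrite /actCn ofCnK. Qed.

Lemma toCn_trans n (s t : n.-tuple M) : toCn (transCn s t) = toCn t + toCn s.
Proof. by rewrite /transCn ofCnK. Qed.

Lemma measurable_act n (A : 'M[R[i]]_n) : measurable_fun setT (actCn A).
Proof.
apply: measurable_ofCn => j; apply: cmeasurable_mulmx => k.
exact: cmeasurable_toCn.
Qed.

Lemma measurable_trans d (X : measurableType d) n (u v : X -> n.-tuple M) :
  measurable_fun setT u -> measurable_fun setT v ->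
  measurable_fun setT (fun x => transCn (u x) (v x)).
Proof.
move=> mu mv; apply: measurable_ofCn => j; under eq_fun do rewrite mxE.
by apply: cmeasurableD; exact: cmeasurable_toCn.
Qed.

End Coordinates.

Section Invariance.
Local Open Scope classical_set_scope.
Local Open Scope ereal_scope.
Context {R : realType}.

(** Invariance is phrased on nonnegative integrals rather than on sets, the form
    in which Tonelli's theorem transports it to products. *)
Definition preserves d (T : measurableType d) (mu : {measure set T -> \bar R})
    (phi : T -> T) := forall f : T -> \bar R, measurable_fun setT f ->
  (forall x, 0 <= f x) -> \int[mu]_x f (phi x) = \int[mu]_x f x.

Lemma preserves_integral d (T : measurableType d)
    (mu : {measure set T -> \bar R}) (phi : T -> T) (f : T -> \bar R) :
  preserves mu phi -> measurable_fun setT f ->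
  \int[mu]_x f (phi x) = \int[mu]_x f x.
Proof.
move=> muphi mf; rewrite [LHS]integralE [RHS]integralE.
congr (_ - _).
  rewrite -(muphi f^\+); [|exact: measurable_funepos|exact: funepos_ge0].
  by apply: eq_integral => x _; rewrite (funepos_comp f phi).
rewrite -(muphi f^\-); [|exact: measurable_funeneg|exact: funeneg_ge0].
by apply: eq_integral => x _; rewrite (funeneg_comp f phi).
Qed.

Lemma preserves_prod d1 d2 (T1 : measurableType d1) (T2 : measurableType d2)
    (m1 : {sigma_finite_measure set T1 -> \bar R})
    (m2 : {sigma_finite_measure set T2 -> \bar R}) phi1 phi2 :
  measurable_fun setT phi1 -> measurable_fun setT phi2 ->
  preserves m1 phi1 -> preserves m2 phi2 ->
  preserves (m1 \x m2) (fun x => (phi1 x.1, phi2 x.2)).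
Proof.
move=> mphi1 mphi2 p1 p2 f mf f0.
rewrite !fubini_tonelli1//; last first.
  apply: measurableT_comp => //; apply: measurable_fun_pair => /=;
    exact: measurableT_comp.
transitivity (\int[m1]_x fubini_F m2 f (phi1 x)).
  apply: eq_integral => x _; apply: (p2 (fun y => f (phi1 x, y))) => //.
  exact: measurableT_comp.
apply: p1; first exact: measurable_fun_fubini_tonelli_F.
by move=> x; exact: integral_ge0.
Qed.

Lemma preserves_translation (a : R) :
  preserves (@lebesgue_measure R) (fun x : measurableTypeR R => (x + a)%R).
Proof.
move=> f mf f0.
have ma : measurable_fun setT (fun x : measurableTypeR R => (x + a)%R : measurableTypeR R).
  exact: measurable_funD.
transitivity (\int[pushforward (@lebesgue_measure R)
    (fun x : measurableTypeR R => (x + a)%R : measurableTypeR R)]_x f x).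
  by rewrite ge0_integral_pushforward.
apply: eq_measure_integral => /= A mA _.
apply/esym; apply: lebesgue_measure_unique => //= _ [[x y]] _ <-.
rewrite /pushforward (_ : _ @^-1` _ = `](x - a)%R, (y - a)%R]%classic).
  rewrite [LHS]lebesgue_measure_itv [RHS]lebesgue_measure_itv/=.
  by rewrite !lte_fin ltrD2r -!EFinB opprB addrA subrK.
by apply/seteqP; split=> z /=; rewrite !in_itv/= ltrBlDr lerBrDr.
Qed.

End Invariance.

(** * Lebesgue measure: translations, Gaussians and boxes *)

Section SqnormCn.
Context {R : realType}.
Local Notation M := (measurableTypeR R * measurableTypeR R)%type.

Lemma sqnormE n (z : 'cV[R[i]]_n) :
  sqnorm z = \sum_j (complex.Re (z j 0) ^+ 2 + complex.Im (z j 0) ^+ 2).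
Proof.
rewrite /sqnorm /cdot raddf_sum/=; apply: eq_bigr => j _.
by case: (z j 0) => a b /=; rewrite mulrN opprK !expr2.
Qed.

Lemma sqnorm_toCn n (t : n.-tuple M) :
  sqnorm (toCn t) = \sum_j ((tnth t j).1 ^+ 2 + (tnth t j).2 ^+ 2).
Proof. by rewrite sqnormE; apply: eq_bigr => j _; rewrite mxE. Qed.

Lemma sqnorm_ge0 n (z : 'cV[R[i]]_n) : 0 <= sqnorm z.
Proof. by rewrite sqnormE sumr_ge0// => j _; rewrite addr_ge0// sqr_ge0. Qed.

Lemma sqnormN n (z : 'cV[R[i]]_n) : sqnorm (- z) = sqnorm z.
Proof.
by rewrite !sqnormE; apply: eq_bigr => j _; rewrite mxE !raddfN/= !sqrrN.
Qed.

Lemma tnth_trans n (s t : n.-tuple M) j : tnth (transCn s t) j =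
  ((tnth t j).1 + (tnth s j).1, (tnth t j).2 + (tnth s j).2).
Proof. by rewrite tnth_mktuple !mxE. Qed.

End SqnormCn.

Section LebesgueCn.
Context {R : realType}.
Local Notation M := (measurableTypeR R * measurableTypeR R)%type.
Local Open Scope classical_set_scope.
Local Open Scope ereal_scope.
Local Notation mu n := (@lebesgue_Cn R n).

Lemma integral_lebesgue_CnS n (f : n.+1.-tuple M -> \bar R) :
  measurable_fun setT f -> (forall t, 0 <= f t) ->
  \int[mu n.+1]_t f t = \int[lebesgue_C \x mu n]_p f (tcons p).
Proof.
move=> mf f0.
rewrite -(@ge0_integral_pushforward _ _ _ _ _ (@tcons R n) (@measurable_tcons R n)
  (lebesgue_C \x mu n) setT f)//.
Qed.

Lemma preserves_trans n (s : n.-tuple M) : preserves (mu n) (transCn s).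
Proof.
elim: n s => [s f mf f0|n IH s f mf f0].
  by apply: eq_integral => t _; congr f; rewrite (tuple0 t); apply: tuple0.
have mT : measurable_fun setT (fun t => transCn s t).
  by apply: measurable_trans => //; exact: measurable_cst.
rewrite !integral_lebesgue_CnS//; last exact: measurableT_comp.
set a := (tnth s ord0).
have mV c : measurable_fun setT (fun x : measurableTypeR R => (x + c)%R : measurableTypeR R).
  exact: measurable_funD.
have mC : measurable_fun setT (fun p : M => ((p.1 + a.1)%R, (p.2 + a.2)%R) : M).
  by apply: measurable_fun_pair; apply: measurableT_comp (mV _) _.
have pC : preserves (@lebesgue_C R) (fun p : M => ((p.1 + a.1)%R, (p.2 + a.2)%R) : M).
  exact: (preserves_prod (mV a.1) (mV a.2) (preserves_translation a.1)
    (preserves_translation a.2)).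
pose s' := (tuncons s).2.
have mT' : measurable_fun setT (transCn s').
  by apply: measurable_trans => //; exact: measurable_cst.
have H := preserves_prod mC mT' pC (IH s').
rewrite -(H (f \o @tcons R n)); last 2 first.
- by apply: measurableT_comp => //; exact: measurable_tcons.
- by move=> x; exact: f0.
apply: eq_integral => -[p t] _ /=; congr f; apply: eq_from_tnth => j.
rewrite tnth_trans; have [k ->|->] := unliftP ord0 j; last by rewrite !tnth0.
rewrite !tnthS tnth_trans; congr (_ + _, _ + _)%R; rewrite /s'/=;
  by rewrite [in LHS](tuple_eta s) tnthS.
Qed.

Definition gauss n (t : n.-tuple M) : R := expR (- sqnorm (toCn t)).

Lemma measurable_sqnorm d (X : measurableType d) n (phi : X -> n.-tuple M) :
  measurable_fun setT phi ->
  measurable_fun setT (fun x => sqnorm (toCn (phi x)) : measurableTypeR R).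
Proof.
move=> mphi; under eq_fun do rewrite sqnormE; apply: measurable_sum => j.
have [m1 m2] := cmeasurable_toCn j mphi.
by apply: measurable_funD; exact: measurable_funX.
Qed.

Lemma integral_gauss1 (b : R) : (0 < b)%R ->
  \int[@lebesgue_measure R]_x (expR (- b * x ^+ 2))%:E < +oo.
Proof.
move=> b0; pose s : R := Num.sqrt ((2 * b)^-1).
have s2 : (s ^+ 2 = (2 * b)^-1)%R by rewrite sqr_sqrtr// invr_ge0 mulr_ge0// ltW.
have s0 : s != 0%R.
  by apply/eqP => s0; move: s2; rewrite s0 expr0n/= => /esym/eqP;
    rewrite invr_eq0 mulf_eq0 (gt_eqF b0) pnatr_eq0.
have E x : expR (- b * x ^+ 2) = ((normal_peak s)^-1 * normal_pdf 0 s x)%R.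
  rewrite normal_pdfE// mulrA mulVf ?mul1r; last by rewrite gt_eqF// normal_peak_gt0.
  rewrite /normal_fun subr0 s2; congr expR; rewrite -mulr_natr.
  by field; rewrite gt_eqF.
under eq_integral do rewrite E EFinM.
rewrite ge0_integralZl//.
- by rewrite integral_normal_pdf mule1 ltry.
- by apply/measurable_EFinP; exact: measurable_normal_pdf.
- by move=> x _; rewrite lee_fin normal_pdf_ge0.
- by rewrite lee_fin invr_ge0 normal_peak_ge0.
Qed.

Lemma integral_gauss_lty n (b : R) : (0 < b)%R ->
  \int[mu n]_t (expR (- b * sqnorm (toCn t)))%:E < +oo.
Proof.
move=> b0.
have mg m : measurable_fun setT (fun t : m.-tuple M => (expR (- b * sqnorm (toCn t)))%:E).
  apply/measurable_EFinP; apply: measurableT_comp => //.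
  by apply: measurable_funM => //; exact: measurable_sqnorm.
have mg1 : measurable_fun setT (fun x : measurableTypeR R => (expR (- b * x ^+ 2))%:E).
  apply/measurable_EFinP; apply: measurableT_comp => //.
  by apply: measurable_funM => //; exact: measurable_funX.
have prod_lty d1 d2 (T1 : measurableType d1) (T2 : measurableType d2)
    (m1 : {sigma_finite_measure set T1 -> \bar R})
    (m2 : {sigma_finite_measure set T2 -> \bar R}) (f1 : T1 -> R) (f2 : T2 -> R) :
    measurable_fun setT (EFin \o f1) -> measurable_fun setT (EFin \o f2) ->
    (forall x, 0 <= f1 x)%R -> (forall x, 0 <= f2 x)%R ->
    \int[m1]_x (f1 x)%:E < +oo -> \int[m2]_x (f2 x)%:E < +oo ->
    \int[m1 \x m2]_p (f1 p.1 * f2 p.2)%:E < +oo.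
  move=> mf1 mf2 f10 f20 l1 l2.
  rewrite fubini_tonelli1//; last 2 first.
  - apply/measurable_EFinP; apply: measurable_funM.
      by apply: measurableT_comp => //; exact/measurable_EFinP.
    by apply: measurableT_comp => //; exact/measurable_EFinP.
  - by move=> x; rewrite lee_fin mulr_ge0.
  have i2 : \int[m2]_x (f2 x)%:E \is a fin_num.
    by rewrite ge0_fin_numE// integral_ge0// => x _; rewrite lee_fin.
  under eq_integral => x _.
    rewrite /fubini_F/=; under eq_integral do rewrite EFinM.
    rewrite ge0_integralZl//; last 2 first.
      by move=> y _; rewrite lee_fin.
      by rewrite lee_fin.
    over.
  rewrite ge0_integralZr//.
  - have i1 : 0 <= \int[m1]_x (f1 x)%:E.
      by apply: integral_ge0 => x _; rewrite lee_fin.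
    by rewrite lte_mul_pinfty// ge0_fin_numE.
  - by move=> x _; rewrite lee_fin.
  - by rewrite integral_ge0// => x _; rewrite lee_fin.
(* The Gaussian of a tuple is the product of the Gaussians of its entries. *)
elim: n => [|n IH].
  by rewrite integral_dirac; [rewrite diracE mem_set// mul1e ltry|by []|exact: mg].
rewrite integral_lebesgue_CnS//.
pose gC (p : M) := (expR (- b * p.1 ^+ 2) * expR (- b * p.2 ^+ 2))%R.
rewrite (eq_integral (fun p => (gC p.1 * expR (- b * sqnorm (toCn p.2)))%:E)).
  apply: (prod_lty _ _ _ _ (@lebesgue_C R) (mu n) gC
    (fun t => expR (- b * sqnorm (toCn t)))) => //.
  - apply/measurable_EFinP; apply: measurable_funM; apply: measurableT_comp => //;
      (apply: measurable_funM => //; exact: measurable_funX).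
  - exact: mg.
  - by move=> x; rewrite mulr_ge0 ?expR_ge0.
  - apply: (prod_lty _ _ _ _ (@lebesgue_measure R) (@lebesgue_measure R)
      (fun x => expR (- b * x ^+ 2)) (fun x => expR (- b * x ^+ 2))) => //.
    + exact: integral_gauss1.
    + exact: integral_gauss1.
move=> [p t] _ /=; rewrite /gC -!expRD; congr (expR _)%:E.
rewrite !sqnorm_toCn big_ord_recl !tnth0 -!mulrDr; congr (_ * (_ + _))%R.
by apply: eq_bigr => j _; rewrite !tnthS.
Qed.

Definition near_tuple n (e : R) (t t' : n.-tuple M) : Prop := forall j,
  (`|(tnth t' j).1 - (tnth t j).1| < e)%R /\ (`|(tnth t' j).2 - (tnth t j).2| < e)%R.

Let near_boxE n (e : R) (t : n.-tuple M) : [set t' | near_tuple e t t'] =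
  [set t' | forall j, (ball (tnth t j).1 e `*` ball (tnth t j).2 e) (tnth t' j)].
Proof.
by apply/seteqP; split => t' H j; have [h1 h2] := H j; split;
  rewrite /ball/= distrC.
Qed.

Lemma measurable_near n (e : R) (t : n.-tuple M) :
  measurable [set t' | near_tuple e t t'].
Proof.
rewrite near_boxE (_ : [set _ | _] = \bigcap_(j in [set: 'I_n])
  ((fun t' : n.-tuple M => tnth t' j) @^-1`
    (ball (tnth t j).1 e `*` ball (tnth t j).2 e))); last first.
  by apply/seteqP; split => t'/= At j => [_|]; exact: At.
apply: fin_bigcap_measurable => // j _.
rewrite -[X in measurable X]setTI; apply: measurable_tnth => //.
by apply: measurableX; exact: measurable_ball.
Qed.

Lemma measure_near_gt0 n (e : R) (t : n.-tuple M) : (0 < e)%R ->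
  0 < mu n [set t' | near_tuple e t t'].
Proof.
move=> e0; rewrite near_boxE (@lebesgue_Cn_box R n
  (fun j => ball (tnth t j).1 e `*` ball (tnth t j).2 e)); last first.
  by move=> j; apply: measurableX; exact: measurable_ball.
elim/big_ind: _ => //; first by move=> x y x0 y0; exact: mule_gt0.
move=> j _; rewrite /lebesgue_C product_measure1E; try exact: measurable_ball.
rewrite [X in _ < X * _](@lebesgue_measure_ball R _ _ (ltW e0)).
rewrite [X in _ < _ * X](@lebesgue_measure_ball R _ _ (ltW e0)).
by rewrite mule_gt0// lte_fin mulrn_wgt0.
Qed.

(** Boxes have positive measure, so a null set contains none: this turns almost
    everywhere statements into pointwise ones for continuous functions. *)
Lemma integral0_near n (f : n.-tuple M -> \bar R) (e : R) (t : n.-tuple M) :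
  measurable_fun setT f -> (forall t, 0 <= f t) -> \int[mu n]_t f t = 0 ->
  (0 < e)%R -> exists2 t', near_tuple e t t' & f t' = 0.
Proof.
move=> mf f0 if0 e0; apply: contrapT => H.
have : \int[mu n]_t `|f t| = 0.
  by rewrite -[RHS]if0; apply: eq_integral => x _; rewrite gee0_abs.
move/(ae_eq_integral_abs _ measurableT mf) => [N [mN N0 sub]].
have : mu n [set t' | near_tuple e t t'] <= mu n N.
  apply: le_measure; rewrite ?inE//; first exact: measurable_near.
  move=> t' ht'; apply: sub => /= H'; apply: H; exists t' => //; exact: H'.
by rewrite N0 leNgt measure_near_gt0.
Qed.

End LebesgueCn.

(** * Norm-preserving linear maps and continuous functions *)

Section UnitaryInvariance.
Context {R : realType} (n : nat).
Local Notation M := (measurableTypeR R * measurableTypeR R)%type.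
Local Notation T := (n.-tuple M).
Local Open Scope classical_set_scope.
Local Open Scope ereal_scope.
Local Notation mu := (@lebesgue_Cn R n).

Lemma measurable_gauss d (X : measurableType d) (phi : X -> T) :
  measurable_fun setT phi -> measurable_fun setT (fun x => (gauss (phi x))%:E).
Proof.
move=> mphi; apply/measurable_EFinP; under eq_fun do rewrite /gauss -mulN1r.
apply: measurableT_comp => //.
by apply: measurable_funM => //; exact: measurable_sqnorm.
Qed.

Lemma integral_gauss_gt0 : 0 < \int[mu]_t (gauss t)%:E.
Proof.
have g0 (t : T) : 0 <= (gauss t)%:E by rewrite lee_fin expR_ge0.
rewrite lt0e integral_ge0 ?andbT//; apply/eqP => I0.
have [|t _ ] := @integral0_near R n (fun t => (gauss t)%:E) 1 (ofCn 0) _ g0 I0 ltr01.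
  exact: measurable_gauss.
by move=> /eqP; rewrite eqe gt_eqF// expR_gt0.
Qed.

Lemma integral_gauss_lty1 : \int[mu]_t (gauss t)%:E < +oo.
Proof.
have := @integral_gauss_lty R n 1 ltr01.
by under eq_integral do rewrite mulN1r.
Qed.

Variables A B : 'M[R[i]]_n.
Hypothesis AB : A *m B = 1%:M.
Hypothesis normA : forall z, sqnorm (A *m z) = sqnorm z.

Let sqnorm_subA (u v : 'cV[R[i]]_n) :
  sqnorm (u - A *m v)%R = sqnorm (v - B *m u)%R.
Proof.
by rewrite -(normA (v - B *m u)%R) mulmxBr mulmxA AB mul1mx -sqnormN opprB.
Qed.

Let gauss_transA (s t : T) :
  gauss (transCn (ofCn (- (A *m toCn t))%R) s) =
  gauss (transCn (ofCn (- (B *m toCn s))%R) t).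
Proof.
have E (a b : T) (C : 'M[R[i]]_n) :
    toCn (transCn (ofCn (- (C *m toCn a))%R) b) = (toCn b - C *m toCn a)%R.
  by rewrite toCn_trans ofCnK.
pose g (z : 'cV[R[i]]_n) : R := expR (- sqnorm z).
apply: (etrans (congr1 g (E t s A))); apply: (etrans _ (esym (congr1 g (E s t B)))).
exact: (congr1 (fun r : R => expR (- r)%R) (sqnorm_subA (toCn s) (toCn t))).
Qed.

Let trans_actA (s t : T) :
  transCn (actCn A (transCn (ofCn (- (B *m toCn s))%R) t)) s = actCn A t.
Proof.
apply: (can_inj (@toCnK R n)); rewrite toCn_trans !toCn_act toCn_trans ofCnK.
by rewrite mulmxBr mulmxA AB mul1mx subrKC.
Qed.

(** The double integral of [gauss y * h (x + A y)] is evaluated twice by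
    Tonelli: integrating in [x] first gives [\int gauss * \int h]; substituting
    [y := y - B x] first and using that [gauss] is even and [A]-invariant gives
    [\int gauss * \int (h o A)]. Then [\int gauss] cancels, being positive and
    finite. *)
Lemma preserves_act : preserves mu (actCn A).
Proof.
move=> h mh h0.
pose G := \int[mu]_t (gauss t)%:E.
have Gfin : G \is a fin_num.
  by rewrite ge0_fin_numE ?integral_gauss_lty1//; exact/ltW/integral_gauss_gt0.
have mA : measurable_fun setT (@actCn R n A) by exact: measurable_act.
have mhA : measurable_fun setT (fun y => h (actCn A y)) by exact: measurableT_comp.
have prodE (k : T -> \bar R) : measurable_fun setT k -> (forall x, 0 <= k x) ->
    \int[mu]_y \int[mu]_x ((gauss y)%:E * k x) = G * \int[mu]_x k x.
  move=> mk k0; under eq_integral => y _.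
    rewrite ge0_integralZl//; last by rewrite lee_fin expR_ge0.
    over.
  rewrite ge0_integralZr//.
  - by apply: measurable_gauss.
  - by move=> x _; rewrite lee_fin expR_ge0.
  - exact: integral_ge0.
have prodE' (k : T -> \bar R) : measurable_fun setT k -> (forall x, 0 <= k x) ->
    \int[mu]_y \int[mu]_x ((gauss x)%:E * k y) = G * \int[mu]_x k x.
  move=> mk k0; under eq_integral => y _.
    rewrite ge0_integralZr//; last 2 first.
    - by apply: measurable_gauss.
    - by move=> x _; rewrite lee_fin expR_ge0.
    over.
  by rewrite ge0_integralZl//; exact/ltW/integral_gauss_gt0.
have k0 (y x : T) : 0 <= (gauss y)%:E * h x by rewrite mule_ge0// lee_fin expR_ge0.
have mtr s : measurable_fun setT (@transCn R n s).
  by apply: measurable_trans => //; exact: measurable_cst.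
suff : G * \int[mu]_x h (actCn A x) = G * \int[mu]_x h x.
  move=> E; have mono := lee_pmul2l Gfin integral_gauss_gt0.
  apply/eqP; rewrite eq_le; apply/andP; split.
    by rewrite -(mono (\int[mu]_x h (actCn A x)) (\int[mu]_x h x)) E lexx.
  by rewrite -(mono (\int[mu]_x h x) (\int[mu]_x h (actCn A x))) E lexx.
apply: (etrans (esym (prodE' (fun x => h (actCn A x)) mhA (fun x => h0 _)))).
apply: (etrans _ (prodE h mh h0)).
transitivity (\int[mu]_y \int[mu]_x
   ((gauss (transCn (ofCn (- (A *m toCn y))%R) x))%:E * h (actCn A y))).
  apply: eq_integral => y _; apply/esym.
  apply: (@preserves_trans R n (ofCn (- (A *m toCn y))%R)
    (fun x => (gauss x)%:E * h (actCn A y))).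
    apply: emeasurable_funM; first exact: measurable_gauss.
    exact: measurable_cst.
  by move=> x; exact: k0.
transitivity (\int[mu]_y \int[mu]_x ((gauss y)%:E * h (transCn (actCn A y) x))); last first.
  apply: eq_integral => y _.
  apply: (@preserves_trans R n (actCn A y) (fun x => (gauss y)%:E * h x)) => //.
  exact: emeasurable_funM.
have mfst : measurable_fun setT (fun p : T * T => p.1) by exact: measurable_fst.
have msnd : measurable_fun setT (fun p : T * T => p.2) by exact: measurable_snd.
pose f1 (p : T * T) := (gauss (transCn (ofCn (- (A *m toCn p.1))%R) p.2))%:E *
  h (actCn A p.1).
have mf1 : measurable_fun setT f1.
  apply: emeasurable_funM; last exact: (measurableT_comp mhA mfst).
  apply: measurable_gauss; apply: measurable_trans => //.
  apply: measurable_ofCn => j; under eq_fun do rewrite mxE -mulN1r.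
  apply: cmeasurableM; first exact: cmeasurable_cst.
  by apply: cmeasurable_mulmx => k; exact: cmeasurable_toCn.
pose f2 (p : T * T) := (gauss p.1)%:E * h (transCn (actCn A p.1) p.2).
have mf2 : measurable_fun setT f2.
  apply: emeasurable_funM; first exact: measurable_gauss.
  apply: measurableT_comp => //; apply: measurable_trans => //.
  exact: measurableT_comp.
have f10 p : 0 <= f1 p by exact: k0.
have f20 p : 0 <= f2 p by exact: k0.
have e1 := @fubini_tonelli _ _ _ _ _ mu mu f1 mf1 f10.
have e2 := @fubini_tonelli _ _ _ _ _ mu mu f2 mf2 f20.
apply: (etrans e1); apply: (etrans _ (esym e2)).
apply: eq_integral => x _.
pose f3 y := (gauss y)%:E * h (transCn (actCn A y) x).
have mf3 : measurable_fun setT f3.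
  apply: emeasurable_funM; first exact: measurable_gauss.
  apply: (measurableT_comp mh).
  exact: (measurable_trans mA (@measurable_cst _ _ _ _ setT x)).
have e3 := @preserves_trans R n (ofCn (- (B *m toCn x))%R) f3 mf3
  (fun y => k0 y (transCn (actCn A y) x)).
apply: (etrans _ e3).
apply: eq_integral => y _.
exact: (congr2 (fun a b => a%:E * h b) (gauss_transA x y) (esym (trans_actA x y))).
Qed.

End UnitaryInvariance.

Section ContinuousMeasurable.
Context {R : realType} (n : nat).
Local Notation M := (measurableTypeR R * measurableTypeR R)%type.
Local Notation T := (n.-tuple M).
Local Open Scope classical_set_scope.

(** A continuous function is the limit of its roundings to the grids of mesh
    [1 / k.+1], each of which takes countably many values on pieces that are
    boxes, hence measurable for the product sigma-algebra. *)
Lemma near_continuous_measurable (F : T -> R) :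
  (forall t e, 0 < e -> exists2 d, 0 < d &
     forall t', near_tuple d t t' -> `|F t' - F t| < e) ->
  measurable_fun setT F.
Proof.
move=> cF.
pose fl k (x : R) : int := Num.floor (x * k.+1%:R).
pose enc k (t : T) : n.-tuple (int * int) :=
  [tuple (fl k (tnth t j).1, fl k (tnth t j).2) | j < n].
pose dec k (s : n.-tuple (int * int)) : T :=
  [tuple ((tnth s j).1%:~R / k.+1%:R, (tnth s j).2%:~R / k.+1%:R) | j < n].
apply: (@measurable_fun_cvg _ _ _ _ (fun k t => F (dec k (enc k t)))).
- move=> k _ Y mY.
  have mfl a : measurable [set y : measurableTypeR R | fl k y = a].
    have k0 : 0 < k.+1%:R :> R by [].
    rewrite (_ : [set _ | _] = `[a%:~R / k.+1%:R, (a + 1)%:~R / k.+1%:R[%classic).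
      exact: measurable_itv.
    apply/seteqP; split => y /=; rewrite in_itv/= ler_pdivrMr// ltr_pdivlMr//.
      by move=> /eqP; rewrite floor_eq.
    by rewrite -floor_eq => /eqP.
  rewrite setTI (_ : _ @^-1` Y = \bigcup_(s : n.-tuple (int * int))
      ([set t | enc k t = s] `&` [set t | Y (F (dec k s))])); last first.
    apply/seteqP; split => t /=; first by exists (enc k t).
    by move=> [s _ /= [<-]].
  apply: countable_bigcupT_measurable; first exact: countableP.
  move=> s; have [Ys|Ys] := pselect (Y (F (dec k s))); last first.
    rewrite (_ : _ `&` _ = set0); first exact: measurable0.
    by apply/seteqP; split => t //= [].
  rewrite (_ : _ `&` _ = \bigcap_(j in [set: 'I_n]) ((fun t : T => tnth t j) @^-1`
     ([set x : measurableTypeR R | fl k x = (tnth s j).1] `*`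
      [set x : measurableTypeR R | fl k x = (tnth s j).2]))); last first.
    apply/seteqP; split => t /=.
      by move=> [<- _] j _ /=; rewrite tnth_mktuple.
    move=> H; split=> //; apply: eq_from_tnth => j; rewrite tnth_mktuple.
    by have [/= -> ->] := H j I; case: (tnth s j).
  apply: fin_bigcap_measurable => // j _.
  rewrite -[X in measurable X]setTI; apply: measurable_tnth => //.
  apply: measurableX; exact: mfl.
- move=> t _; apply/cvgrPdist_lt => e e0.
  have [d d0 Hd] := cF t e e0.
  have [N HN] : exists N : nat, d^-1 < N%:R.
    by exists (Num.bound d^-1); apply: archi_boundP; rewrite invr_ge0 ltW.
  near=> k; rewrite distrC; apply: Hd => j; rewrite !tnth_mktuple/=.
  have dk : k.+1%:R^-1 < d.
    rewrite invf_plt ?posrE//; apply: (lt_le_trans HN); rewrite ler_nat.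
    by apply: leqW; near: k; exact: nbhs_infty_ge.
  have fle x : `|(fl k x)%:~R / k.+1%:R - x| < d.
    have k0 : 0 < k.+1%:R :> R by [].
    have /andP[l1 l2] := floor_itv (x * k.+1%:R).
    rewrite -/(fl k x) intrD in l1 l2.
    have a1 : (fl k x)%:~R / k.+1%:R <= x by rewrite ler_pdivrMr.
    have a2 : x < (fl k x)%:~R / k.+1%:R + k.+1%:R^-1.
      by rewrite -[X in _ + X]mul1r -mulrDl ltr_pdivlMr.
    move: a1 a2 dk; set q := _ / _; set r := _^-1 => a1 a2 dk.
    by rewrite ltr_norml; apply/andP; split; lra.
  by split; exact: fle.
Unshelve. all: by end_near.
Qed.

End ContinuousMeasurable.

(** * Moduli and holomorphic functions *)

Section ComplexModulus.
Context {R : rcfType}.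
Implicit Types x y : R[i].

Lemma normr_normc x : `|x| = (normc x)%:C%C.
Proof. by case: x. Qed.

Lemma normc_ge0 x : 0 <= normc x.
Proof. by case: x => a b; exact: sqrtr_ge0. Qed.

Lemma sqr_normcE x : normc x ^+ 2 = complex.Re x ^+ 2 + complex.Im x ^+ 2.
Proof. by case: x => a b; rewrite /= sqr_sqrtr// addr_ge0// sqr_ge0. Qed.

Lemma Re_le_normc x : `|complex.Re x| <= normc x.
Proof. by rewrite -lecR -normr_normc normc_ge_Re. Qed.

Lemma Im_le_normc x : `|complex.Im x| <= normc x.
Proof.
rewrite -(@ler_pXn2r _ 2)// ?nnegrE ?normc_ge0// sqr_normcE.
by rewrite -normrX ger0_norm ?sqr_ge0// lerDr sqr_ge0.
Qed.

Lemma normc_le_ReIm x : normc x <= `|complex.Re x| + `|complex.Im x|.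
Proof.
rewrite -(@ler_pXn2r _ 2)// ?nnegrE ?normc_ge0 ?addr_ge0// sqr_normcE sqrrD.
rewrite -!normrX !(ger0_norm (sqr_ge0 _)) lerD2r lerDl.
by rewrite mulrn_wge0// mulr_ge0.
Qed.

Lemma ReM x y : complex.Re (x * y) =
  complex.Re x * complex.Re y - complex.Im x * complex.Im y.
Proof. by case: x => a b; case: y => a' b'. Qed.

Lemma ImM x y : complex.Im (x * y) =
  complex.Re x * complex.Im y + complex.Im x * complex.Re y.
Proof. by case: x => a b; case: y => a' b'. Qed.

Lemma ReD x y : complex.Re (x + y) = complex.Re x + complex.Re y.
Proof. by case: x => a b; case: y. Qed.

Lemma ImD x y : complex.Im (x + y) = complex.Im x + complex.Im y.
Proof. by case: x => a b; case: y. Qed.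

Lemma ReB x y : complex.Re (x - y) = complex.Re x - complex.Re y.
Proof. by case: x => a b; case: y. Qed.

Lemma ImB x y : complex.Im (x - y) = complex.Im x - complex.Im y.
Proof. by case: x => a b; case: y. Qed.

Lemma ReC x : complex.Re x^* = complex.Re x. Proof. by case: x. Qed.
Lemma ImC x : complex.Im x^* = - complex.Im x. Proof. by case: x. Qed.

End ComplexModulus.

Lemma holomorphic_expansion (K : numFieldType) n (f : 'cV[K]_n -> K) (p : 'cV[K]_n) :
  holomorphic f -> exists L : {linear 'cV[K]_n -> K^o}, forall e : K, 0 < e ->
    exists2 d : K, 0 < d & forall w, `|w| < d ->
      `|f (w + p) - (f p + L w)| <= e * `|w|.
Proof.
move=> hf; exists ('d (f : 'cV[K]_n -> K^o) p) => e e0.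
have /eqaddoP/(_ e e0)/nbhs_ballP[d d0 Hd] := diff_locally (hf p).
exists d => // w wd; apply: (Hd w).
by rewrite mx_norm_ball /ball_/= sub0r normrN.
Qed.

Section HolomorphicClosure.
Context {K : numFieldType} (n : nat).
Implicit Types (f g : 'cV[K]_n -> K).

Lemma holomorphic_cst (k : K) : holomorphic (fun _ : 'cV[K]_n => k).
Proof. by move=> z; exact: differentiable_cst. Qed.

Lemma holomorphicD f g : holomorphic f -> holomorphic g ->
  holomorphic (fun z => f z + g z).
Proof. by move=> hf hg z; exact: (differentiableD (hf z) (hg z)). Qed.

Lemma holomorphicZ (k : K) f : holomorphic f -> holomorphic (fun z => k * f z).
Proof. by move=> hf z; exact: (differentiableZ k (hf z)). Qed.

Lemma holomorphic_coord (j : 'I_n) : holomorphic (fun z : 'cV[K]_n => z j 0).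
Proof. by move=> z; exact: differentiable_coord. Qed.

Lemma holomorphic_mulmx (A : 'M[K]_n) f : holomorphic f ->
  holomorphic (fun z => f (A *m z)).
Proof.
move=> hf z.
apply: (@differentiable_comp _ _ _ _ (mulmx A : 'cV[K]_n -> 'cV[K]_n) (f : _ -> K^o)) => //.
rewrite (_ : mulmx A = \sum_k (fun w : 'cV[K]_n => w k 0 *: col k A)).
  by apply: differentiable_sum => k; apply: differentiableZl; exact: differentiable_coord.
apply/funext => w; apply/colP => i; rewrite fct_sumE summxE mxE.
by apply: eq_bigr => k _; rewrite !mxE mulrC.
Qed.

End HolomorphicClosure.

Section Holomorphic.
Context {R : realType} (n : nat).
Local Notation K := (R[i]).
Implicit Types (f g : 'cV[K]_n -> K) (z w : 'cV[K]_n).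
Local Open Scope classical_set_scope.

Let posc (e : K) : 0 < e -> exists2 d : R, 0 < d & e = d%:C%C.
Proof.
by case: e => a b; rewrite ltcE/= => /andP[/eqP -> a0]; exists a.
Qed.

Lemma holomorphic_near f : holomorphic f -> forall z (e : R), 0 < e ->
  exists2 d : R, 0 < d & forall w, (forall j, normc (w j 0 - z j 0) < d) ->
    normc (f w - f z) < e.
Proof.
move=> hf z e e0; have := differentiable_continuous (hf z).
move=> /cvgrPdist_lt/(_ e%:C%C); rewrite ltcR => /(_ e0).
move=> /nbhs_ballP[e' /= /posc[d d0 ->] H]; exists d => // w wz.
have := H w; rewrite -opprB normrN normr_normc ltcR; apply; split; first by rewrite ltcR.
by move=> i j; rewrite ord1 /ball/= -opprB normrN normr_normc ltcR.
Qed.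

Lemma holomorphic_line f : holomorphic f -> forall z (l : K), exists D : K,
  forall e : R, 0 < e -> exists2 d : R, 0 < d & forall h : K, normc h < d ->
    normc (f ((l + h) *: z) - f (l *: z) - D * h) <= e * normc h.
Proof.
move=> hf z l; have [L Ho] := holomorphic_expansion (l *: z) hf.
exists (L z) => e e0.
have [c c0 cE] : exists2 c : R, 0 < c & `|z| <= c%:C%C.
  have := normr_ge0 z; case: (`|z|) => a b; rewrite lecE/= => /andP[/eqP b0 a0].
  exists (a + 1); first by rewrite ltr_wpDl.
  by rewrite lecE/= b0 eqxx/= lerDl.
have ec0 : 0 < e / c by rewrite divr_gt0.
have := Ho (e / c)%:C%C; rewrite ltcR => /(_ ec0) [d' /posc[d d0 ->] Hd].
exists (d / c) => [|h hd]; first by rewrite divr_gt0.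
have bh : `|h *: z| < d%:C%C.
  rewrite normrZ normr_normc.
  apply: (@le_lt_trans _ _ ((normc h)%:C%C * c%:C%C)).
    by apply: ler_wpM2l => //; rewrite lecR normc_ge0.
  by rewrite -rmorphM ltcR -ltr_pdivlMr.
have := Hd _ bh; rewrite normrZ (normr_normc h) normr_normc => H.
have {}H : (normc (f (h *: z + l *: z) - (f (l *: z) + L (h *: z))))%:C%C <=
   (e / c)%:C%C * ((normc h)%:C%C * c%:C%C) :> K.
  apply: (le_trans H); apply: ler_wpM2l; first by rewrite lecR ltW.
  by apply: ler_wpM2l => //; rewrite lecR normc_ge0.
rewrite -!rmorphM lecR in H; move: H.
have -> : e / c * (normc h * c) = e * normc h by field; rewrite gt_eqF.
have LE : L (h *: z) = L z * h by rewrite linearZ mulrC.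
by rewrite LE -scalerDl (addrC h) opprD [X in normc X](@addrA K).
Qed.

End Holomorphic.

(** * The mean value property on circles *)

Section CircleMean.
Context {R : realType}.
Local Open Scope classical_set_scope.

Lemma is_derive_expansion (f : R -> R) (x l : R) : is_derive x 1 f l ->
  forall e : R, 0 < e -> exists2 d : R, 0 < d &
    forall h : R, `|h| < d -> `|f (x + h) - f x - l * h| <= e * `|h|.
Proof.
move=> [df fl] e e0; have /diff_locally/eqaddoP := (derivable1_diffP f x).1 df.
move=> /(_ e e0)/nbhs_ballP[d /= d0 Hd]; exists d => // h hd.
have := Hd h; rewrite /ball/= sub0r normrN => /(_ hd).
have dE : 'd f x h = l * h.
  rewrite -fl deriveE; last exact/derivable1_diffP.
  by rewrite -[h in LHS]mulr1 -[h * 1]/(h *: (1 : R^o)) linearZ/= mulrC.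
have -> : (f \o +%R^~ x - (cst (f x) + 'd f x)) h = f (h + x) - (f x + 'd f x h) by [].
by rewrite dE (addrC h) opprD addrA.
Qed.

(** The complex exponential of [s + i t]. *)
Definition cexp (s t : R) : R[i] := ((expR s * cos t) +i* (expR s * sin t))%C.

Lemma cexpD s t x y : cexp (s + x) (t + y) = cexp s t * cexp x y.
Proof.
by rewrite /cexp expRD cosD sinD; congr (_ +i* _)%C; rewrite /=; ring.
Qed.

Lemma cexp0 : cexp 0 0 = 1.
Proof. by rewrite /cexp expR0 cos0 sin0 mulr1 mulr0. Qed.

Lemma normc_cexp s t : normc (cexp s t) = expR s.
Proof.
apply/eqP; rewrite -(@eqrXn2 _ 2)// ?normc_ge0 ?expR_ge0// sqr_normcE/=.
by rewrite !exprMn -mulrDr cos2Dsin2 mulr1.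
Qed.

Lemma cexp_expansion (e : R) : 0 < e -> exists2 d : R, 0 < d & forall x y : R,
  `|x| < d -> `|y| < d ->
  normc (cexp x y - 1 - (x +i* y)%C) <= e * (`|x| + `|y|).
Proof.
move=> e0.
have e12 : 0 < e / 12 by rewrite divr_gt0.
have [d1 d10 H1] := is_derive_expansion (is_derive_expR (0 : R)) e12.
have [d2 d20 H2] := is_derive_expansion (is_derive_cos (0 : R)) e12.
have [d3 d30 H3] := is_derive_expansion (is_derive_sin (0 : R)) e12.
rewrite expR0 in H1; rewrite cos0 sin0 in H2; rewrite cos0 sin0 in H3.
have [d4 d40 H4] := is_derive_expansion (is_derive_expR (0 : R)) ltr01.
rewrite expR0 in H4.
pose m := Num.min (Num.min d1 d2) (Num.min (Num.min d3 d4) (Num.min 1 (e / 12))).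
exists m => [|x y]; first by rewrite !lt_min d10 d20 d30 d40 ltr01 e12.
rewrite !lt_min => /andP[/andP[x1 _] /andP[/andP[_ x4] /andP[x5 x6]]].
move=> /andP[/andP[_ y2] /andP[/andP[y3 _] _]].
set ex := expR x; set cy := cos y; set sy := sin y.
have A1 : `|ex - 1 - x| <= e / 12 * `|x| by have := H1 x x1; rewrite add0r mul1r.
have A2 : `|cy - 1| <= e / 12 * `|y|.
  by have := H2 y y2; rewrite add0r oppr0 mul0r subr0.
have A3 : `|sy - y| <= e / 12 * `|y|.
  by have := H3 y y3; rewrite add0r subr0 mul1r.
have A4 : `|ex - 1 - x| <= `|x| by have := H4 x x4; rewrite add0r !mul1r.
have ex2 : `|ex - 1| <= 2 * `|x|.
  have -> : ex - 1 = (ex - 1 - x) + x by ring.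
  by apply: (le_trans (ler_normD _ _)); rewrite mulr2n mulrDl mul1r lerD2r.
have ex3 : `|ex| <= 3.
  have -> : ex = (ex - 1) + 1 by ring.
  apply: (le_trans (ler_normD _ _)); rewrite normr1; lra.
have nx := normr_ge0 x; have ny := normr_ge0 y.
have R1 : `|ex * cy - 1 - x| <= e / 12 * `|x| + e / 4 * `|y|.
  have -> : ex * cy - 1 - x = (ex - 1 - x) + ex * (cy - 1) by ring.
  apply: (le_trans (ler_normD _ _)); apply: lerD => //; rewrite normrM.
  apply: (@le_trans _ _ (3 * (e / 12 * `|y|))); first exact: ler_pM.
  by rewrite le_eqVlt; apply/orP; left; apply/eqP; field.
have R2 : `|ex * sy - y| <= e / 4 * `|y| + e / 6 * `|y|.
  have -> : ex * sy - y = ex * (sy - y) + (ex - 1) * y by ring.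
  apply: (le_trans (ler_normD _ _)); apply: lerD; rewrite normrM.
    apply: (@le_trans _ _ (3 * (e / 12 * `|y|))); first exact: ler_pM.
    by rewrite le_eqVlt; apply/orP; left; apply/eqP; field.
  apply: ler_wpM2r => //; apply: (le_trans ex2); lra.
apply: (le_trans (normc_le_ReIm _)); rewrite /= oppr0 addr0.
apply: (le_trans (lerD R1 R2)).
have : 0 <= e * `|x| by rewrite mulr_ge0// ltW.
have : 0 <= e * `|y| by rewrite mulr_ge0// ltW.
lra.
Qed.

(** In logarithmic polar coordinates the real and imaginary parts of an entire
    function of one variable form a closed pair: this is the Cauchy-Riemann
    equation for [s + i t |-> f (exp (s + i t) z)]. *)
Lemma holomorphic_closed n (f : 'cV[R[i]]_n -> R[i]) (z : 'cV[R[i]]_n) s t :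
  holomorphic f ->
  closed_at (fun s t => complex.Im (f (cexp s t *: z)))
            (fun s t => complex.Re (f (cexp s t *: z))) s t.
Proof.
move=> hf; set l := cexp s t.
have [D HD] := holomorphic_line hf z l.
set k := D * l.
exists (complex.Im k), (complex.Re k), (- complex.Im k) => e e0.
pose N := normc k + normc l + 1.
have nl0 := normc_ge0 l; have nk0 := normc_ge0 k.
have N0 : 0 < N by rewrite /N; lra.
pose e1 := Num.min 1 (e / (2 * N)).
have e10 : 0 < e1 by rewrite lt_min ltr01/= divr_gt0// mulr_gt0.
have [d1 d10 H1] := cexp_expansion e10.
have e20 : 0 < e / (4 * N) by rewrite divr_gt0// mulr_gt0.
have [d2 d20 H2] := HD _ e20.
pose d := Num.min d1 (d2 / (4 * N)).
exists d => [|s' t']; first by rewrite lt_min d10 divr_gt0// mulr_gt0.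
rewrite !lt_min => /andP[x1 x2] /andP[y1 y2].
set x := s' - s; set y := t' - t.
set a := `|x| + `|y|.
have a0 : 0 <= a by rewrite addr_ge0.
pose r := cexp x y - 1 - (x +i* y)%C.
have rle : normc r <= e1 * a by exact: H1.
have e11 : e1 <= 1 by rewrite ge_min lexx.
have e12 : e1 <= e / (2 * N) by rewrite ge_min lexx orbT.
pose h := l * (cexp x y - 1).
have lh : cexp s' t' = l + h.
  rewrite /h mulrBr mulr1 -cexpD subrKC /x /y !subrKC//.
have xya : normc (x +i* y)%C <= a by exact: normc_le_ReIm.
have hle : normc h <= normc l * (2 * a).
  rewrite normcM; apply: ler_wpM2l => //.
  have -> : cexp x y - 1 = r + (x +i* y)%C by rewrite /r subrK.
  apply: (le_trans (le_normcD _ _)).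
  have := ler_wpM2r a0 e11; lra.
have hd2 : normc h < d2.
  apply: (le_lt_trans hle).
  have lN : normc l * (2 * a) <= N * (2 * a).
    by apply: ler_wpM2r; [rewrite mulr_ge0|rewrite /N; lra].
  apply: (le_lt_trans lN).
  have : a < d2 / (4 * N) + d2 / (4 * N) by rewrite ltrD.
  have -> : d2 / (4 * N) + d2 / (4 * N) = d2 / (N * 2) by field; rewrite gt_eqF.
  by rewrite ltr_pdivlMr ?mulr_gt0//; lra.
have {}H2 := H2 h hd2.
set w := f (cexp s' t' *: z) - f (l *: z).
have wE : w - k * (x +i* y)%C = (w - D * h) + k * r.
  by rewrite /r /k /h; ring.
have main : normc (w - k * (x +i* y)%C) <= e * a.
  rewrite wE; apply: (le_trans (le_normcD _ _)).
  rewrite /w lh normcM.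
  have b1 : e / (4 * N) * normc h <= e / 2 * a.
    apply: (@le_trans _ _ (e / (4 * N) * (N * (2 * a)))).
      apply: ler_wpM2l; first exact: ltW.
      apply: (le_trans hle); apply: ler_wpM2r; [by rewrite mulr_ge0|rewrite /N; lra].
    by rewrite le_eqVlt; apply/orP; left; apply/eqP; field; rewrite gt_eqF.
  have b2 : normc k * normc r <= e / 2 * a.
    apply: (@le_trans _ _ (N * (e / (2 * N) * a))).
      apply: ler_pM => //; [exact: normc_ge0|rewrite /N; lra|].
      by apply: (le_trans rle); exact: ler_wpM2r.
    by rewrite le_eqVlt; apply/orP; left; apply/eqP; field; rewrite gt_eqF.
  by have := le_trans H2 b1; lra.
split.
  apply: le_trans main; apply: le_trans (Im_le_normc _).
  rewrite le_eqVlt; apply/orP; left; apply/eqP; congr `|_|.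
  have kI : complex.Im (k * (x +i* y)%C) = complex.Re k * y + complex.Im k * x.
    exact: ImM.
  by rewrite /w !ImB kI; ring.
apply: le_trans main; apply: le_trans (Re_le_normc _).
rewrite le_eqVlt; apply/orP; left; apply/eqP; congr `|_|.
have kR : complex.Re (k * (x +i* y)%C) = complex.Re k * x - complex.Im k * y.
  exact: ReM.
by rewrite /w !ReB kR; ring.
Qed.

Lemma circle_continuous n (f : 'cV[R[i]]_n -> R[i]) (z : 'cV[R[i]]_n) s :
  holomorphic f -> continuous (fun t => complex.Re (f (cexp s t *: z))).
Proof.
move=> hf; exact: (@closed_continuousr R
  (fun s t => complex.Im (f (cexp s t *: z)))
  (fun s t => complex.Re (f (cexp s t *: z)))
  (fun s t => holomorphic_closed z s t hf) s).
Qed.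

(** By Goursat's theorem the integral of [Re f] over the circle of radius
    [expR s] does not depend on [s]; as [s] tends to [-oo] it tends to
    [2 pi * Re (f 0)] by continuity. *)
Lemma circle_mean n (f : 'cV[R[i]]_n -> R[i]) (z : 'cV[R[i]]_n) :
  holomorphic f ->
  segint 0 (pi *+ 2) (fun t => complex.Re (f (cexp 0 t *: z))) =
  complex.Re (f 0) * (pi *+ 2).
Proof.
move=> hf.
pose P s t := complex.Im (f (cexp s t *: z)).
pose Q s t := complex.Re (f (cexp s t *: z)).
have PQ s t : closed_at P Q s t by exact: holomorphic_closed.
have pi20 : 0 <= pi *+ 2 :> R by rewrite mulrn_wge0// pi_ge0.
have cQ s : continuous (Q s) by exact: circle_continuous.
have const l : 0 <= l -> segint 0 (pi *+ 2) (Q (- l)) = segint 0 (pi *+ 2) (Q 0).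
  move=> l0; have := circulation_eq0 PQ (- l) 0 l0 pi20.
  have E1 : (fun x => P x 0 - P x (pi *+ 2)) = (fun=> 0 : R).
    by apply/funext => x; rewrite /P /cexp cos2pi sin2pi cos0 sin0 subrr.
  have E2 := segintB 0 (pi *+ 2) (cQ 0) (cQ (- l)).
  have E3 : segint (- l) 0 (fun=> 0 : R) = 0.
    by rewrite segint_cst ?mul0r// oppr_le0.
  rewrite /circulation add0r addNr E1 E3 E2 add0r => /subr0_eq E.
  exact: esym E.
apply/eqP; rewrite -subr_eq0 -normr_le0; apply/ler_addgt0Pr => e e0; rewrite add0r.
have p0 : 0 < (pi *+ 2 : R) by rewrite mulrn_wgt0// pi_gt0.
have [d d0 Hd] := holomorphic_near hf 0 (divr_gt0 e0 p0).
pose c := \sum_j normc (z j 0) + 1.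
have c0 : 0 < c by rewrite /c ltr_wpDl// sumr_ge0// => j _; exact: normc_ge0.
have [l l0 Hl] : exists2 l : R, 0 <= l & expR (- l) * c < d.
  have [N HN] : exists N : nat, c / d < N%:R.
    by exists (Num.bound (c / d)); apply: archi_boundP; rewrite divr_ge0// ltW.
  exists N%:R => //; rewrite expRN mulrC ltr_pdivrMr ?expR_gt0//.
  rewrite mulrC -ltr_pdivrMr//; apply: (lt_le_trans HN).
  by apply: le_trans (expR_ge1Dx _); rewrite lerDr.
rewrite -[X in segint _ _ X]/(Q 0) -(const l l0).
have := @segint_near_cst R 0 (pi *+ 2) (Q (- l)) (complex.Re (f 0))
  (e / (pi *+ 2)) pi20 (cQ _).
rewrite subr0 divfK ?gt_eqF//; apply => t _.
rewrite /Q -ReB; apply: (le_trans (Re_le_normc _)); apply: ltW; apply: Hd => j.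
rewrite !mxE subr0 normcM normc_cexp; apply: le_lt_trans Hl.
apply: ler_wpM2l; first exact: expR_ge0.
rewrite /c (bigD1 j)//= -addrA lerDl addr_ge0// sumr_ge0// => i _; exact: normc_ge0.
Qed.

End CircleMean.

(** * Growth and measurability of the weight *)

Section Weight.
Context {R : realType}.
Implicit Types f : R -> R.
Local Open Scope classical_set_scope.

Lemma hderiv_expansion f (y : R) : hderivable f -> 0 <= y ->
  forall e : R, 0 < e -> exists2 d : R, 0 < d & forall x, 0 <= x -> `|x - y| < d ->
    `|f x - f y - hderiv f y * (x - y)| <= e * `|x - y|.
Proof.
move=> hf y0 e e0; have /cvgrPdist_le/(_ e e0) := hf y y0.
move=> [d /= d0 Hd]; exists d => // x x0 xy.
have [->|xNy] := eqVneq x y; first by rewrite !subrr mulr0 subr0 normr0 mulr0.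
have xy0 : x - y != 0 by rewrite subr_eq0.
have := Hd x; rewrite /ball/= (distrC y) => /(_ xy xNy x0) H.
have -> : f x - f y - hderiv f y * (x - y) =
    ((f x - f y) / (x - y) - hderiv f y) * (x - y) by rewrite mulrBl divfK.
by rewrite normrM (distrC _ (hderiv f y)); exact: ler_wpM2r.
Qed.

Lemma is_derive_hderiv f (y : R) : hderivable f -> 0 < y -> is_derive y 1 f (hderiv f y).
Proof.
move=> hf y0.
have H : (fun h => h^-1 *: (f (h *: 1 + y) - f y)) @ 0^' --> hderiv f y.
  apply/cvgrPdist_le => e e0.
  have [d d0 Hd] := hderiv_expansion hf (ltW y0) e0.
  exists (Num.min d y); first by rewrite /= lt_min d0 y0.
  move=> h /=; rewrite sub0r normrN lt_min => /andP[hd hy] h0.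
  have := Hd (h + y); rewrite addrK => /(_ _ hd).
  rewrite ltr_norml in hy; move: hy => /andP[hy1 hy2].
  have -> : 0 <= h + y by lra.
  move=> /(_ isT); rewrite -ler_pdivrMr ?normr_gt0// => H.
  apply: le_trans H; rewrite le_eqVlt -normfV -normrM distrC; apply/orP; left.
  apply/eqP; congr `|_|; rewrite -[h%:A]/(h * 1) mulr1 mulrBl mulfK//.
  by rewrite -[_ *: _]/(_ * _) mulrC.
apply: DeriveDef; first by apply/cvg_ex; exists (hderiv f y).
by apply: (@cvg_lim _ _ _ _ _ _ (hderiv f y)) => //; exact: norm_hausdorff.
Qed.

Lemma hderiv_mvt f (a b : R) : hderivable f -> 0 < a -> a < b ->
  exists2 c, a < c < b & f b - f a = hderiv f c * (b - a).
Proof.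
move=> hf a0 ab.
have [x||c] := @MVT R f (hderiv f) a b ab.
- by rewrite in_itv/= => /andP[ax _]; apply: is_derive_hderiv => //; exact: lt_trans ax.
- apply: derivable_within_continuous => x; rewrite in_itv/= => /andP[ax _].
  by have [] := is_derive_hderiv hf (lt_le_trans a0 ax).
- by rewrite in_itv/=; exists c.
Qed.

(** The half-line derivatives constrain [f] on nonnegative reals only, hence the
    truncation; a squared norm is not affected by it. *)
Lemma hderivable_measurable f : hderivable f ->
  measurable_fun setT (fun y : measurableTypeR R => f (Num.max 0 y) : measurableTypeR R).
Proof.
move=> hf; apply: continuous_measurable_fun => y0.
apply/cvgrPdist_lt => e e0; set m := Num.max 0 y0.
have m0 : 0 <= m by rewrite le_max lexx.
have [d d0 Hd] := hderiv_expansion hf m0 ltr01.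
set D := hderiv f m; have k0 : 0 < `|D| + 1 by rewrite ltr_wpDl.
exists (Num.min d (e / (`|D| + 1))) => [/=|y /=].
  by rewrite lt_min d0 divr_gt0.
rewrite distrC lt_min => /andP[yd ye].
have ym : `|Num.max 0 y - m| <= `|y - y0|.
  have A := ler_norm (y - y0); have := ler_norm (y0 - y); rewrite (distrC y0) => B.
  have d00 := normr_ge0 (y - y0); rewrite /m; move: (`|y - y0|) A B d00 => q A B d00.
  by rewrite /Num.max; case: ifPn; case: ifPn; rewrite -?leNgt => h1 h2;
    rewrite ler_norml; apply/andP; split; lra.
have z0 : 0 <= Num.max 0 y by rewrite le_max lexx.
have := Hd _ z0 (le_lt_trans ym yd); rewrite mul1r => H.
rewrite distrC; rewrite ltr_pdivlMr// in ye; apply: le_lt_trans ye.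
set z := Num.max 0 y in ym z0 H *.
have -> : f z - f m = (f z - f m - D * (z - m)) + D * (z - m) by ring.
apply: (le_trans (ler_normD _ _)); rewrite normrM.
apply: (@le_trans _ _ ((`|D| + 1) * `|z - m|)).
  by rewrite mulrDl mul1r addrC lerD2l.
by rewrite mulrC; apply: ler_wpM2r => //; exact: ltW.
Qed.

Context (n : nat) (psi : R -> R).
Hypothesis hpsi : admissible_weight n psi.

Let psi1 : hderivable psi.
Proof. by have [+ _] := weight_C3 hpsi; move=> /(_ 0%N isT). Qed.

Let psi2 : hderivable (hderiv psi).
Proof. by have [+ _] := weight_C3 hpsi; move=> /(_ 1%N isT). Qed.

(** [psi] is convex and increasing, hence grows at least linearly. *)
Lemma weight_linear_growth : exists2 a : R, 0 < a &
  forall y, 0 <= y -> a * (y - 1) <= psi y.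
Proof.
exists (hderiv psi 1) => [|y y0]; first exact: (weight_deriv1 hpsi).
have a0 : 0 < hderiv psi 1 by exact: (weight_deriv1 hpsi).
have [y1|y1] := leP y 1.
  apply: (@le_trans _ _ 0); last exact: (weight_ge0 hpsi).
  by rewrite pmulr_rle0 ?subr_le0.
have [c /andP[c1 cy] E] := hderiv_mvt psi1 ltr01 y1.
(* Applying the mean value theorem away from [0] avoids one-sided derivatives. *)
have [b /andP[b1 _] E2] := hderiv_mvt psi2 ltr01 c1.
have p1 := weight_ge0 hpsi (@ler01 R).
have mono : hderiv psi 1 <= hderiv psi c.
  rewrite -subr_ge0 E2 mulr_ge0 ?subr_ge0 ?(ltW c1)//.
  by apply: (weight_deriv2 hpsi); rewrite ltW// (lt_trans _ b1).
apply: (@le_trans _ _ (psi y - psi 1)); last by rewrite gerBl.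
by rewrite E; apply: ler_wpM2r => //; rewrite subr_ge0 ltW.
Qed.

Lemma measurable_fock_weight d (X : measurableType d)
    (phi : X -> n.-tuple (measurableTypeR R * measurableTypeR R)) :
  measurable_fun setT phi ->
  measurable_fun setT (fun x => fock_weight psi (toCn (phi x)) : measurableTypeR R).
Proof.
move=> mphi; rewrite /fock_weight.
have E x : psi (sqnorm (toCn (phi x))) = psi (Num.max 0 (sqnorm (toCn (phi x)))).
  by rewrite max_r// sqnorm_ge0.
under eq_fun do rewrite E -mulN1r.
apply: measurableT_comp => //; apply: measurable_funM => //.
exact: (measurableT_comp (hderivable_measurable psi1) (measurable_sqnorm mphi)).
Qed.

End Weight.

(** * Complex-valued integrals *)

Section ComplexIntegral.
Context {R : realType} (n : nat).
Local Notation K := (R[i]).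
Local Notation M := (measurableTypeR R * measurableTypeR R)%type.
Local Notation T := (n.-tuple M).
Local Notation mu := (@lebesgue_Cn R n).
Local Open Scope classical_set_scope.
Implicit Types u v : 'cV[K]_n -> K.

Definition cintegrable u : Prop :=
  mu.-integrable setT (EFin \o (fun t => complex.Re (u (toCn t)))) /\
  mu.-integrable setT (EFin \o (fun t => complex.Im (u (toCn t)))).

Lemma complex_eq (x y : K) :
  complex.Re x = complex.Re y -> complex.Im x = complex.Im y -> x = y.
Proof. by case: x => a b; case: y => a' b' /= -> ->. Qed.

Lemma cintegralD u v : cintegrable u -> cintegrable v ->
  cintegral (fun z => u z + v z) = cintegral u + cintegral v.
Proof.
move=> [u1 u2] [v1 v2]; apply: complex_eq.
  rewrite ReD /=; under eq_Rintegral do rewrite ReD.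
  exact: RintegralD.
rewrite ImD /=; under eq_Rintegral do rewrite ImD.
exact: RintegralD.
Qed.

Lemma integrableZ_real (k : R) (f : T -> R) :
  mu.-integrable setT (EFin \o f) -> mu.-integrable setT (EFin \o (fun t => k * f t)).
Proof. by move=> fi; apply: (integrableZl measurableT k fi). Qed.

Lemma cintegralZ (k : K) u : cintegrable u ->
  cintegral (fun z => k * u z) = k * cintegral u.
Proof.
move=> [u1 u2]; apply: complex_eq.
  rewrite ReM /=; under eq_Rintegral do rewrite ReM.
  rewrite RintegralB//; [by rewrite !RintegralZl|exact: integrableZ_real..].
rewrite ImM /=; under eq_Rintegral do rewrite ImM.
rewrite RintegralD//; [by rewrite !RintegralZl|exact: integrableZ_real..].
Qed.

Lemma cintegral_conj u : cintegrable u ->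
  cintegral (fun z => (u z)^*) = (cintegral u)^*.
Proof.
move=> [u1 u2]; apply: complex_eq.
  by rewrite ReC /=; under eq_Rintegral do rewrite ReC.
rewrite ImC /=; under eq_Rintegral do rewrite ImC -mulN1r.
by rewrite RintegralZl// mulN1r.
Qed.

Lemma Rintegral_act (A B : 'M[K]_n) (h : 'cV[K]_n -> R) :
  A *m B = 1%:M -> (forall z, sqnorm (A *m z) = sqnorm z) ->
  measurable_fun setT (fun t : T => h (toCn t) : measurableTypeR R) ->
  \int[mu]_t h (A *m toCn t) = \int[mu]_t h (toCn t).
Proof.
move=> AB nA mh; rewrite /Rintegral; congr fine.
rewrite -(@preserves_integral _ _ _ _ _ (fun t : T => (h (toCn t))%:E)
  (preserves_act AB nA)); last exact/measurable_EFinP.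
by apply: eq_integral => t _; rewrite toCn_act.
Qed.

Lemma cintegral_act (A B : 'M[K]_n) u :
  A *m B = 1%:M -> (forall z, sqnorm (A *m z) = sqnorm z) ->
  cmeasurable (fun t : T => u (toCn t)) ->
  cintegral (fun z => u (A *m z)) = cintegral u.
Proof.
move=> AB nA [m1 m2]; apply: complex_eq => /=.
  exact: (Rintegral_act (h := fun z => complex.Re (u z)) AB nA).
exact: (Rintegral_act (h := fun z => complex.Im (u z)) AB nA).
Qed.

Lemma holomorphic_cmeasurable d (X : measurableType d) (phi : X -> T) u :
  holomorphic u -> measurable_fun setT phi ->
  cmeasurable (fun x => u (toCn (phi x))).
Proof.
move=> hu mphi.
have near t (e : R) : 0 < e -> exists2 d, 0 < d & forall t', near_tuple d t t' ->
    normc (u (toCn t') - u (toCn t)) < e.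
  move=> e0; have [d' d0 Hd] := holomorphic_near hu (toCn t) e0.
  exists (d' / 2) => [|t' tt']; first by rewrite divr_gt0.
  apply: Hd => j; have [t1 t2] := tt' j; rewrite !mxE.
  apply: (le_lt_trans (normc_le_ReIm _)); rewrite ReB ImB /=; lra.
split.
  apply: (@measurableT_comp _ _ _ _ _ _ (fun t => complex.Re (u (toCn t)))) => //.
  apply: near_continuous_measurable => t e /(near t)[d' d0 Hd].
  exists d' => // t' /Hd; apply: le_lt_trans.
  by rewrite -ReB; exact: Re_le_normc.
apply: (@measurableT_comp _ _ _ _ _ _ (fun t => complex.Im (u (toCn t)))) => //.
apply: near_continuous_measurable => t e /(near t)[d' d0 Hd].
exists d' => // t' /Hd; apply: le_lt_trans.
by rewrite -ImB; exact: Im_le_normc.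
Qed.

End ComplexIntegral.

(** * The inner product space of weighted square-integrable entire functions *)

Section Fock.
Context {R : realType} (n : nat) (psi : R -> R).
Hypothesis hpsi : admissible_weight n psi.
Local Notation K := (R[i]).
Local Notation Cn := ('cV[K]_n).
Local Notation M := (measurableTypeR R * measurableTypeR R)%type.
Local Notation T := (n.-tuple M).
Local Notation mu := (@lebesgue_Cn R n).
Local Open Scope classical_set_scope.
Implicit Types f g h : Cn -> K.
Local Notation w := (fock_weight psi).
Local Notation inner := (fock_inner psi).

Let w_gt0 (z : Cn) : 0 < w z. Proof. exact: expR_gt0. Qed.
Let w_ge0 (z : Cn) : 0 <= w z. Proof. exact: expR_ge0. Qed.

Let mw : measurable_fun setT (fun t : T => w (toCn t) : measurableTypeR R).
Proof. exact: (measurable_fock_weight hpsi). Qed.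

Definition fock_density f (t : T) : R := normc (f (toCn t)) ^+ 2 * w (toCn t).

Lemma measurable_density f : holomorphic f ->
  measurable_fun setT (fun t => fock_density f t : measurableTypeR R).
Proof.
move=> hf; have [m1 m2] := @holomorphic_cmeasurable _ _ _ _ id _ hf (@measurable_id _ _ setT).
rewrite /fock_density; under eq_fun do rewrite sqr_normcE.
by apply: measurable_funM => //; apply: measurable_funD; exact: measurable_funX.
Qed.

Lemma emeasurable_density f : holomorphic f ->
  measurable_fun setT (EFin \o fock_density f).
Proof. by move=> hf; apply/measurable_EFinP; exact: measurable_density. Qed.

Lemma density_ge0 f t : 0 <= fock_density f t.
Proof. by rewrite mulr_ge0// sqr_ge0. Qed.

Lemma fockP f : fock psi f <->
  holomorphic f /\ mu.-integrable setT (EFin \o fock_density f).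
Proof.
have E : (\int[mu]_t `|(EFin \o fock_density f) t| =
    \int[mu]_t (normc (f (toCn t)) ^+ 2 * w (toCn t))%:E)%E.
  by apply: eq_integral => t _; rewrite /= ger0_norm ?density_ge0.
split=> [[hf foo]|[hf /integrableP[_ foo]]]; split=> //; last by rewrite -E.
apply/integrableP; split; last by rewrite E.
exact: emeasurable_density.
Qed.

Lemma fock_dominated f (G : T -> R) : holomorphic f ->
  mu.-integrable setT (EFin \o G) -> (forall t, fock_density f t <= G t) -> fock psi f.
Proof.
move=> hf Gi fG; apply/fockP; split=> //.
apply: le_integrable Gi => //; first exact: emeasurable_density.
move=> t _ /=; rewrite lee_fin ger0_norm ?density_ge0//.
exact: le_trans (fG t) (ler_norm _).
Qed.

Lemma integrableD_real (f g : T -> R) :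
  mu.-integrable setT (EFin \o f) -> mu.-integrable setT (EFin \o g) ->
  mu.-integrable setT (EFin \o (fun t => f t + g t)).
Proof. by move=> fi gi; apply: (integrableD measurableT fi gi). Qed.

Lemma fockZD (a : K) f g : fock psi f -> fock psi g -> fock psi (fun z => a * f z + g z).
Proof.
move=> /fockP[hf fi] /fockP[hg gi].
apply: (@fock_dominated _ (fun t => 2 * normc a ^+ 2 * fock_density f t +
  2 * fock_density g t)).
- exact: (holomorphicD (holomorphicZ a hf) hg).
- by apply: integrableD_real; exact: integrableZ_real.
move=> t; rewrite /fock_density.
have -> : 2 * normc a ^+ 2 * (normc (f (toCn t)) ^+ 2 * w (toCn t)) +
    2 * (normc (g (toCn t)) ^+ 2 * w (toCn t)) =
    (2 * (normc a * normc (f (toCn t))) ^+ 2 + 2 * normc (g (toCn t)) ^+ 2) *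
      w (toCn t) by ring.
apply: ler_wpM2r => //.
have := normc_ge0 (a * f (toCn t)); have := normc_ge0 (g (toCn t)).
have := le_normcD (a * f (toCn t)) (g (toCn t)).
rewrite -normcM.
move: (normc_ge0 (a * f (toCn t) + g (toCn t))).
move: (normc (_ + _)) (normc (_ * _)) (normc (g _)) => p q r p0 pqr r0 q0.
have : p ^+ 2 <= (q + r) ^+ 2 by rewrite ler_pXn2r// nnegrE addr_ge0.
have := sqr_ge0 (q - r); rewrite sqrrB sqrrD => A B.
apply: (le_trans B); rewrite -mulr_natl in A; rewrite -mulr_natl; lra.
Qed.

Lemma integrable_polygauss :
  mu.-integrable setT (EFin \o (fun t => (1 + sqnorm (toCn t)) * w (toCn t))).
Proof.
have [a a0 Ha] := weight_linear_growth hpsi.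
have ms : measurable_fun setT (fun t : T => sqnorm (toCn t) : measurableTypeR R).
  exact: measurable_sqnorm.
(* Half of the exponent [a] pays for the polynomial factor. *)
pose b := a / 2.
have b0 : 0 < b by rewrite divr_gt0.
pose c := (1 + b^-1) * expR a.
have gi : mu.-integrable setT (EFin \o (fun t => expR (- b * sqnorm (toCn t)))).
  apply/integrableP; split.
    apply/measurable_EFinP; apply: measurableT_comp => //.
    exact: measurable_funM.
  under eq_integral => t _ do rewrite /= ger0_norm ?expR_ge0//.
  exact: integral_gauss_lty.
apply: le_integrable (integrableZ_real c gi) => //.
  apply/measurable_EFinP; apply: measurable_funM => //; exact: measurable_funD.
move=> t _ /=; rewrite lee_fin; apply: le_trans (ler_norm _).
have s0 := sqnorm_ge0 (toCn t); have := Ha _ s0; rewrite /fock_weight.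
move: (sqnorm _) s0 => s s0 pa.
rewrite ger0_norm; last by rewrite mulr_ge0 ?expR_ge0// addr_ge0.
have -> : c * expR (- b * s) = ((1 + b^-1) * expR (b * s)) * expR (- (a * (s - 1))).
  by rewrite /c -!mulrA -!expRD; congr (_ * expR _); rewrite /b; field.
apply: ler_pM; rewrite ?expR_ge0 ?addr_ge0//.
  have e1 : 1 <= expR (b * s) by rewrite -expR0 ler_expR mulr_ge0// ltW.
  have e2 : 1 + b * s <= expR (b * s) by exact: expR_ge1Dx.
  rewrite mulrDl mul1r; apply: lerD => //.
  by rewrite mulrC ler_pdivlMr// mulrC; lra.
by rewrite ler_expR lerN2.
Qed.

Lemma fock_cst (k : K) : fock psi (fun _ : Cn => k).
Proof.
apply: (@fock_dominated _ (fun t => normc k ^+ 2 * ((1 + sqnorm (toCn t)) * w (toCn t)))).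
- exact: holomorphic_cst.
- by apply: integrableZ_real; exact: integrable_polygauss.
move=> t; rewrite /fock_density; apply: ler_wpM2l; first exact: sqr_ge0.
by rewrite ler_peMl// lerDl sqnorm_ge0.
Qed.

Lemma fock_coord j : fock psi (fun z : Cn => z j 0).
Proof.
apply: (@fock_dominated _ (fun t => (1 + sqnorm (toCn t)) * w (toCn t))).
- exact: holomorphic_coord.
- exact: integrable_polygauss.
move=> t; rewrite /fock_density; apply: ler_wpM2r => //.
rewrite sqr_normcE sqnormE (bigD1 j)//= addrCA lerDl addr_ge0// sumr_ge0// => i _.
by rewrite addr_ge0// sqr_ge0.
Qed.

Lemma fockZ a f : fock psi f -> fock psi (fun z => a * f z).
Proof.
move=> ff; have := fockZD a ff (fock_cst 0).
by congr fock; apply/funext => z; rewrite addr0.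
Qed.

Lemma fockB f g : fock psi f -> fock psi g -> fock psi (fun z => f z - g z).
Proof.
move=> ff fg; have := fockZD (-1) fg ff.
by congr fock; apply/funext => z; rewrite mulN1r addrC.
Qed.

Lemma cmeasurable_integrand f g : holomorphic f -> holomorphic g ->
  cmeasurable (fun t : T => f (toCn t) * (g (toCn t))^* * (w (toCn t))%:C%C).
Proof.
move=> hf hg; apply: cmeasurableM; last by split; [exact: mw|exact: measurable_cst].
apply: cmeasurableM; last apply: cmeasurable_conj;
  exact: (@holomorphic_cmeasurable _ _ _ _ id).
Qed.

Lemma cintegrable_fock f g : fock psi f -> fock psi g ->
  cintegrable (fun z => f z * (g z)^* * (w z)%:C%C).
Proof.
move=> /fockP[hf fi] /fockP[hg gi]; have [m1 m2] := cmeasurable_integrand hf hg.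
have bound t : normc (f (toCn t) * (g (toCn t))^* * (w (toCn t))%:C%C) <=
    `|fock_density f t + fock_density g t|.
  have nw : normc (w (toCn t))%:C%C = w (toCn t).
    by rewrite /= expr0n/= addr0 sqrtr_sqr ger0_norm.
  have nJ (x : K) : normc x^* = normc x by case: x => a b; rewrite /= sqrrN.
  rewrite ger0_norm ?addr_ge0 ?density_ge0// !normcM nw nJ /fock_density -mulrDl.
  apply: ler_wpM2r => //.
  move: (normc_ge0 (f (toCn t))) (normc_ge0 (g (toCn t))).
  move: (normc _) (normc _) => p q p0 q0.
  have := sqr_ge0 (p - q); have := mulr_ge0 p0 q0; rewrite sqrrB -mulr_natl; lra.
have fgi := integrableD_real fi gi.
split; apply: le_integrable fgi => //; try exact/measurable_EFinP.
  by move=> t _ /=; rewrite lee_fin; exact: le_trans (Re_le_normc _) (bound t).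
by move=> t _ /=; rewrite lee_fin; exact: le_trans (Im_le_normc _) (bound t).
Qed.

Lemma innerZl a f g : fock psi f -> fock psi g ->
  inner (fun z => a * f z) g = a * inner f g.
Proof.
move=> ff fg; rewrite /fock_inner -cintegralZ; last exact: cintegrable_fock.
by congr cintegral; apply/funext => z; rewrite !mulrA.
Qed.

Lemma innerDl f g h : fock psi f -> fock psi g -> fock psi h ->
  inner (fun z => f z + g z) h = inner f h + inner g h.
Proof.
move=> ff fg fh; rewrite /fock_inner -cintegralD; try exact: cintegrable_fock.
by congr cintegral; apply/funext => z; rewrite !mulrDl.
Qed.

Lemma innerC f g : fock psi f -> fock psi g -> inner g f = (inner f g)^*.
Proof.
move=> ff fg; rewrite /fock_inner -cintegral_conj; last exact: cintegrable_fock.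
congr cintegral; apply/funext => z; rewrite !rmorphM/= conjCK.
rewrite [X in _ = _ * X](_ : _ = (w z)%:C%C); first by rewrite [X in X * _]mulrC.
by apply/eqP; rewrite eq_complex /= oppr0 !eqxx.
Qed.

Lemma innerBl f g h : fock psi f -> fock psi g -> fock psi h ->
  inner (fun z => f z - g z) h = inner f h - inner g h.
Proof.
move=> ff fg fh.
have -> : (fun z => f z - g z) = (fun z => f z + -1 * g z).
  by apply/funext => z; rewrite mulN1r.
by rewrite (innerDl ff (fockZ (-1) fg) fh) (innerZl (-1) fg fh) mulN1r.
Qed.

Lemma innerBr f g h : fock psi f -> fock psi g -> fock psi h ->
  inner h (fun z => f z - g z) = inner h f - inner h g.
Proof.
move=> ff fg fh; rewrite (innerC (fockB ff fg) fh) (innerBl ff fg fh) rmorphB/=.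
by rewrite -(innerC ff fh) -(innerC fg fh).
Qed.

Lemma innerZr a f g : fock psi f -> fock psi g ->
  inner f (fun z => a * g z) = a^* * inner f g.
Proof.
move=> ff fg; rewrite (innerC (fockZ a fg) ff) (innerZl a fg ff) rmorphM/=.
by rewrite -(innerC fg ff).
Qed.

Lemma Re_inner f : complex.Re (inner f f) = \int[mu]_t fock_density f t.
Proof.
rewrite /=; apply: eq_Rintegral => t _; rewrite ReM /= mulr0 subr0; congr (_ * _).
by case: (f _) => a b; rewrite /= sqr_sqrtr ?addr_ge0 ?sqr_ge0// mulrN opprK -!expr2.
Qed.

Lemma Re_inner_ge0 f : 0 <= complex.Re (inner f f).
Proof. by rewrite Re_inner; apply: Rintegral_ge0 => t _; exact: density_ge0. Qed.

Lemma Im_inner f : fock psi f -> complex.Im (inner f f) = 0.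
Proof.
move=> ff; have := congr1 (@complex.Im R) (innerC ff ff); rewrite ImC => /eqP.
by rewrite -addr_eq0 -mulr2n mulrn_eq0 => /eqP.
Qed.

Lemma sqr_fock_norm f : fock_norm psi f ^+ 2 = complex.Re (inner f f).
Proof. by rewrite sqr_sqrtr// Re_inner_ge0. Qed.

(** An element of norm zero vanishes everywhere, not only almost everywhere,
    because it is continuous and boxes have positive measure. *)
Lemma inner_definite f : fock psi f -> complex.Re (inner f f) = 0 -> forall z, f z = 0.
Proof.
move=> /fockP[hf fi]; rewrite Re_inner => I0 z.
have E0 : (\int[mu]_t (fock_density f t)%:E = 0)%E.
  by rewrite -(fineK (integrable_fin_num measurableT fi)); congr EFin.
apply: contrapT => /eqP fz0.
have nf0 : 0 < normc (f z).
  by rewrite lt0r normc_ge0 andbT; apply/eqP => /eq0_normc/eqP; exact/negP.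
have [d d0 Hd] := holomorphic_near hf z nf0.
have d20 : 0 < d / 2 by rewrite divr_gt0.
have mf : measurable_fun setT (fun t => (fock_density f t)%:E).
  exact: emeasurable_density.
have f0 (t : T) : (0 <= (fock_density f t)%:E)%E by rewrite lee_fin density_ge0.
have [t tz /eqP] := integral0_near (ofCn z) mf f0 E0 d20.
rewrite eqe mulf_eq0 (gt_eqF (w_gt0 _)) orbF sqrf_eq0 => /eqP/eq0_normc ft0.
have := Hd (toCn t); rewrite ft0 sub0r normcN ltxx => H.
have // : false; apply: H => j; have [t1 t2] := tz j.
rewrite !mxE; rewrite tnth_mktuple/= in t1 t2.
apply: (le_lt_trans (normc_le_ReIm _)); rewrite ReB ImB /=; lra.
Qed.

End Fock.

(** * Symmetries of the inner product and the mean value property *)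

Section FockSymmetry.
Context {R : realType} (n : nat) (psi : R -> R).
Hypothesis hpsi : admissible_weight n psi.
Local Notation K := (R[i]).
Local Notation Cn := ('cV[K]_n).
Local Notation M := (measurableTypeR R * measurableTypeR R)%type.
Local Notation T := (n.-tuple M).
Local Notation mu := (@lebesgue_Cn R n).
Local Open Scope classical_set_scope.
Implicit Types f g h : Cn -> K.
Local Notation w := (fock_weight psi).
Local Notation inner := (fock_inner psi).

Lemma weight_act (A : 'M[K]_n) (z : Cn) :
  (forall z, sqnorm (A *m z) = sqnorm z) -> w (A *m z) = w z.
Proof. by move=> nA; rewrite /fock_weight nA. Qed.

Lemma inner_act (A B : 'M[K]_n) f g :
  A *m B = 1%:M -> (forall z, sqnorm (A *m z) = sqnorm z) ->
  holomorphic f -> holomorphic g ->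
  inner (fun z => f (A *m z)) (fun z => g (A *m z)) = inner f g.
Proof.
move=> AB nA hf hg; rewrite /fock_inner.
rewrite -(cintegral_act (u := fun z => f z * (g z)^* * (w z)%:C%C) AB nA).
  by congr cintegral; apply/funext => z; rewrite weight_act.
exact: (cmeasurable_integrand hpsi).
Qed.

Lemma fock_act (A B : 'M[K]_n) f :
  A *m B = 1%:M -> (forall z, sqnorm (A *m z) = sqnorm z) ->
  fock psi f -> fock psi (fun z => f (A *m z)).
Proof.
move=> AB nA [hf foo]; split; first exact: holomorphic_mulmx.
have := @preserves_integral _ _ _ _ (actCn A)
  (fun t : T => (normc (f (toCn t)) ^+ 2 * w (toCn t))%:E) (preserves_act AB nA).
move=> /(_ (emeasurable_density hpsi hf)) E.
apply: (eq_ind _ (fun x => (x < +oo)%E) foo); apply: (etrans (esym E)).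
by apply: eq_integral => t _; rewrite toCn_act weight_act.
Qed.

Lemma sqnorm_scale (c : K) (z : Cn) : sqnorm (c *: z) = normc c ^+ 2 * sqnorm z.
Proof.
rewrite !sqnormE mulr_sumr; apply: eq_bigr => j _.
by rewrite -!sqr_normcE mxE normcM exprMn.
Qed.

Lemma sqnorm_phase t (z : Cn) : sqnorm ((cexp 0 t)%:M *m z) = sqnorm z.
Proof. by rewrite mul_scalar_mx sqnorm_scale normc_cexp expR0 expr1n mul1r. Qed.

Lemma phase_inv (t : R) : (cexp 0 t)%:M *m (cexp 0 (- t))%:M = 1%:M :> 'M[K]_n.
Proof. by rewrite -scalar_mxM -cexpD addr0 subrr cexp0. Qed.

Lemma integral_itv_continuous (a b : R) (u : R -> R) : continuous u ->
  (\int[@lebesgue_measure R]_(x in `[a, b]) (u x)%:E = (segint a b u)%:E)%E.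
Proof.
move=> cu; rewrite /segint /Rintegral fineK//.
by apply: integrable_fin_num => //; exact: segint_integrable.
Qed.

Lemma segintZr (a b k : R) (u : R -> R) : continuous u ->
  segint a b (fun x => u x * k) = segint a b u * k.
Proof. by move=> cu; apply: RintegralZr => //; exact: segint_integrable. Qed.

(** Fubini's theorem for [Re (f (exp (i s) z)) * w z] over angles [s] in
    [0, 2 pi] and points [z]: for each angle the integral over [z] is that of
    [Re f * w], by rotation invariance, and for each [z] the integral over the
    angle is [2 pi * Re (f 0) * w z], by the mean value property on circles. *)
Lemma Re_mean_value f : fock psi f ->
  \int[mu]_t (complex.Re (f (toCn t)) * w (toCn t)) =
  complex.Re (f 0) * \int[mu]_t w (toCn t).
Proof.
move=> ff; have [hf _] := ff.
pose D : set (measurableTypeR R) := `[0, pi *+ 2]%classic.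
have pi20 : 0 <= pi *+ 2 :> R by rewrite mulrn_wge0// pi_ge0.
have pi0 : 0 < pi *+ 2 :> R by rewrite mulrn_wgt0// pi_gt0.
pose u (s : R) (t : T) := complex.Re (f (cexp 0 s *: toCn t)) * w (toCn t).
pose F (p : measurableTypeR R * T) : \bar R := (\1_D p.1 * u p.1 p.2)%:E.
have cexpm d (X : measurableType d) (phi : X -> measurableTypeR R) :
    measurable_fun setT phi -> cmeasurable (fun x => cexp 0 (phi x)).
  move=> mphi; split; rewrite /cexp /=; apply: measurable_funM => //.
    apply: (measurableT_comp _ mphi); apply: continuous_measurable_fun.
    exact: continuous_cos.
  apply: (measurableT_comp _ mphi); apply: continuous_measurable_fun.
  exact: continuous_sin.
have mphi : measurable_fun setT
    (fun p : measurableTypeR R * T => ofCn (cexp 0 p.1 *: toCn p.2)).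
  apply: measurable_ofCn => j; under eq_fun do rewrite mxE.
  by apply: cmeasurableM; [exact: cexpm|exact: cmeasurable_toCn].
have [mRe _] := holomorphic_cmeasurable hf mphi.
have mF : measurable_fun setT F.
  apply/measurable_EFinP; apply: measurable_funM.
    apply: (measurableT_comp _ measurable_fst).
    by apply: measurable_indic; exact: measurable_itv.
  apply: measurable_funM.
    by under eq_fun do rewrite -[_ *: _]ofCnK.
  exact: (measurable_fock_weight hpsi).
have mw : measurable_fun setT (fun t : T => w (toCn t) : measurableTypeR R).
  exact: (measurable_fock_weight hpsi).
have [mf _] := @holomorphic_cmeasurable _ _ _ _ id f hf (@measurable_id _ _ setT).
pose v (t : T) := complex.Re (f (toCn t)) * w (toCn t).
have mv : measurable_fun setT (fun t => v t : measurableTypeR R).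
  exact: measurable_funM.
have vi : mu.-integrable setT (EFin \o v).
  have [vi _] := cintegrable_fock hpsi ff (fock_cst hpsi 1).
  congr (mu.-integrable setT _) : vi; apply/funext => t /=; congr EFin.
  by rewrite rmorph1 mulr1 ReM /= mulr0 subr0.
have wi : mu.-integrable setT (EFin \o (fun t => w (toCn t))).
  have [_ wi] := (fockP hpsi _).1 (fock_cst hpsi 1).
  congr (mu.-integrable setT _) : wi; apply/funext => t /=; congr EFin.
  by rewrite /fock_density normc1 expr1n mul1r.
have vact s t : v (actCn (cexp 0 s)%:M t) = u s t.
  by rewrite /v /u toCn_act (weight_act _ (sqnorm_phase s)) mul_scalar_mx.
have mus s : measurable_fun setT (fun t => u s t : measurableTypeR R).
  have := measurableT_comp mv (@measurable_act R n (cexp 0 s)%:M).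
  congr measurable_fun; apply/funext => t; exact: vact.
have rot (G : R -> R) s :
    measurable_fun setT (fun x : measurableTypeR R => G x : measurableTypeR R) ->
    (\int[mu]_t (G (u s t))%:E = \int[mu]_t (G (v t))%:E)%E.
  move=> mG.
  rewrite -(@preserves_integral _ _ _ _ _ (fun t => (G (v t))%:E)
     (preserves_act (phase_inv s) (sqnorm_phase s))).
    by apply: eq_integral => t _; rewrite vact.
  by apply/measurable_EFinP; exact: (measurableT_comp mG mv).
have D2pi : (\int[@lebesgue_measure R]_s (\1_D s)%:E = (pi *+ 2)%:E)%E.
  rewrite integral_indic//; last exact: measurable_itv.
  rewrite setIT [LHS]lebesgue_measure_itv/= lte_fin pi0.
  by rewrite oppr0 addr0.
have abs_int : (\int[mu]_t `|(v t)%:E| < +oo)%E by have /integrableP[] := vi.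
pose I1 := fine (\int[mu]_t (v t)%:E).
have I1E : (\int[mu]_t (v t)%:E = I1%:E)%E.
  by rewrite /I1 fineK//; exact: integrable_fin_num.
pose J1 := fine (\int[mu]_t `|(v t)%:E|).
have J1E : (\int[mu]_t `|(v t)%:E| = J1%:E)%E.
  by rewrite /J1 fineK// ge0_fin_numE// integral_ge0.
have D01 s : (\1_D s = 0 :> R) \/ (\1_D s = 1 :> R).
  by rewrite indicE; case: (s \in D) => /=; [right|left].
have D0 s : 0 <= \1_D s :> R by have [->|->] := D01 s.
have mulD (k : R) : (\int[@lebesgue_measure R]_s (\1_D s * k)%:E = (pi *+ 2 * k)%:E)%E.
  have iD : (@lebesgue_measure R).-integrable setT (EFin \o \1_D).
    apply/integrableP; split.
      by apply/measurable_EFinP; apply: measurable_indic; exact: measurable_itv.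
    by under eq_integral => s _ do rewrite /= ger0_norm//; rewrite D2pi ltry.
  under eq_integral do rewrite mulrC EFinM.
  by rewrite (integralZl measurableT iD) D2pi -EFinM mulrC.
have Fi : (@lebesgue_measure R \x mu)%E.-integrable setT F.
  apply/(integrable12ltyP _ _ mF).
  have E s : (\int[mu]_t `|F (s, t)| = (\1_D s * J1)%:E)%E.
    rewrite EFinM -J1E -(rot (fun x => `|x|) s); last exact: normr_measurable.
    rewrite -ge0_integralZl//.
    - by apply: eq_integral => t _; rewrite /F/= normrM ger0_norm.
    - apply/measurable_EFinP; apply: (measurableT_comp (@normr_measurable R setT)).
      exact: mus.
  by under eq_integral => s _ do rewrite E; rewrite mulD ltry.
have fub := Fubini Fi.
have L : (\int[@lebesgue_measure R]_s \int[mu]_t F (s, t) = (pi *+ 2 * I1)%:E)%E.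
  rewrite -mulD; apply: eq_integral => s _; rewrite /F/=.
  have [->|->] := D01 s.
    rewrite mul0r; under eq_integral do rewrite mul0r.
    by rewrite integral0.
  rewrite mul1r -I1E -(rot id s)//.
  by apply: eq_integral => t _; rewrite mul1r.
have RR : (\int[mu]_t \int[@lebesgue_measure R]_s F (s, t) =
    (pi *+ 2 * complex.Re (f 0) * \int[mu]_t w (toCn t))%:E)%E.
  rewrite -RintegralZl//.
  rewrite [X in (_ = X%:E)%E]/Rintegral fineK; last first.
    by apply: integrable_fin_num => //; exact: integrableZ_real.
  apply: eq_integral => t _.
  have cQ : continuous (fun s => complex.Re (f (cexp 0 s *: toCn t))).
    exact: circle_continuous.
  have cu : continuous (fun s => u s t).
    by move=> s; apply: cvgM; [exact: cQ|exact: cvg_cst].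
  transitivity (\int[@lebesgue_measure R]_(s in D) (u s t)%:E)%E.
    rewrite [RHS]integral_mkcond; apply: eq_integral => s _.
    rewrite /F /patch /= indicE; case: ifPn => _; last by rewrite mul0r.
    by rewrite mul1r.
  rewrite (integral_itv_continuous _ _ cu) /u (segintZr _ _ _ cQ) circle_mean//.
  by rewrite [_ * (pi *+ 2)]mulrC.
move: fub; rewrite L RR => -[] E.
by apply: (mulfI (lt0r_neq0 pi0)); rewrite mulrA -E.
Qed.

Lemma mean_value f : fock psi f ->
  inner f (fun _ : Cn => 1) = f 0 * inner (fun _ : Cn => 1) (fun _ : Cn => 1).
Proof.
move=> ff; have W : inner (fun _ : Cn => 1) (fun _ : Cn => 1) = (\int[mu]_t w (toCn t))%:C%C.
  apply: complex_eq; last by rewrite (Im_inner hpsi)//; exact: (fock_cst hpsi).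
  by rewrite Re_inner; apply: eq_Rintegral => t _; rewrite /fock_density normc1 expr1n mul1r.
have ReI g : complex.Re (inner g (fun _ : Cn => 1)) =
    \int[mu]_t (complex.Re (g (toCn t)) * w (toCn t)).
  rewrite /=; apply: eq_Rintegral => t _.
  by rewrite rmorph1 mulr1 ReM /= mulr0 subr0.
have ReF g : fock psi g -> complex.Re (inner g (fun _ : Cn => 1)) =
    complex.Re (g 0) * \int[mu]_t w (toCn t).
  by move=> fg; rewrite ReI Re_mean_value.
(* The imaginary part is the real part after multiplication by [- 'i]. *)
have Imi (x : K) : complex.Im x = complex.Re (- 'i%C * x).
  by case: x => a b; rewrite /=; ring.
rewrite W; apply: complex_eq.
  by rewrite (ReF _ ff) ReM /= mulr0 subr0.
rewrite Imi -(innerZl hpsi)//; last exact: (fock_cst hpsi).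
rewrite ReF; last exact: (fockZ hpsi).
by rewrite -Imi ImM /= mulr0 add0r.
Qed.

(** The reflection changing the sign of the coordinate [j] preserves inner
    products, and turns the inner product of two distinct coordinates into its
    opposite. *)
Lemma inner_coord j k : inner (fun z : Cn => z j 0) (fun z => z k 0) =
  (j == k)%:R * inner (fun z : Cn => z j 0) (fun z => z j 0).
Proof.
have [<-|jk] := eqVneq j k; first by rewrite mul1r.
rewrite mul0r.
pose d : 'rV[K]_n := \row_l (if l == j then -1 else 1).
have dz (z : Cn) l : (diag_mx d *m z) l 0 = d 0 l * z l 0 by rewrite mul_diag_mx mxE.
have dd : diag_mx d *m diag_mx d = 1%:M.
  rewrite mulmx_diag -diag_const_mx; congr diag_mx; apply/rowP => l; rewrite !mxE.
  by case: ifP => _; rewrite ?mulrNN mulr1.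
have nd z : sqnorm (diag_mx d *m z) = sqnorm z.
  rewrite !sqnormE; apply: eq_bigr => l _; rewrite -!sqr_normcE dz normcM mxE.
  by case: ifP => _; rewrite ?normcN normc1 mul1r.
have := inner_act dd nd (@holomorphic_coord K n j) (@holomorphic_coord K n k).
rewrite (_ : (fun z : Cn => (diag_mx d *m z) j 0) = (fun z => -1 * z j 0)); last first.
  by apply/funext => z; rewrite dz mxE eqxx.
rewrite (_ : (fun z : Cn => (diag_mx d *m z) k 0) = (fun z => z k 0)); last first.
  by apply/funext => z; rewrite dz mxE eq_sym (negPf jk) mul1r.
rewrite (innerZl hpsi); try exact: (fock_coord hpsi).
by rewrite mulN1r => /eqP; rewrite eq_sym -addr_eq0 -mulr2n mulrn_eq0 => /eqP.
Qed.

(** A permutation matrix preserves inner products and exchanges coordinates. *)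
Lemma inner_coord_diag j k : inner (fun z : Cn => z j 0) (fun z => z j 0) =
  inner (fun z : Cn => z k 0) (fun z => z k 0).
Proof.
pose s := tperm j k.
pose A : 'M[K]_n := perm_mx s.
have sz (z : Cn) l : (A *m z) l 0 = z (s l) 0 by rewrite /A -row_permE mxE.
have ss : A *m A = 1%:M by rewrite /A -perm_mxM tperm2 perm_mx1.
have ns z : sqnorm (A *m z) = sqnorm z.
  rewrite !sqnormE [RHS](reindex_inj (@perm_inj _ s)).
  by apply: eq_bigr => l _; rewrite sz.
apply: (etrans (esym (inner_act ss ns (@holomorphic_coord K n j)
  (@holomorphic_coord K n j)))).
have E : (fun z : Cn => (A *m z) j 0) = (fun z => z k 0).
  by apply/funext => z; rewrite sz tpermL.
by rewrite E.
Qed.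

End FockSymmetry.

(** * Co-isometric weighted composition operators *)

Section UnitaryOperator.
Context {R : realType} (n : nat) (psi : R -> R).
Hypothesis hpsi : admissible_weight n psi.
Local Notation K := (R[i]).
Local Notation Cn := ('cV[K]_n).
Local Open Scope sesquilinear_scope.
Implicit Types f g h : Cn -> K.
Local Notation inner := (fock_inner psi).

Lemma sqnorm_unitary (C : 'M[K]_n) (z : Cn) : C \is unitarymx -> sqnorm (C *m z) = sqnorm z.
Proof.
move=> /unitarymxP/mulmx1C CC; rewrite /sqnorm; congr complex.Re.
have cdotE (x : Cn) : cdot x x = (x ^t* *m x) 0 0.
  by rewrite mxE; apply: eq_bigr => j _; rewrite !mxE mulrC.
by rewrite !cdotE trmx_mul map_mxM -mulmxA (mulmxA _ C) CC mul1mx.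
Qed.

Lemma fock_norm_eq f g : inner f f = inner g g -> fock_norm psi f = fock_norm psi g.
Proof. by rewrite /fock_norm => ->. Qed.

Lemma inner_eq_norm f g : fock psi f -> fock psi g ->
  fock_norm psi f = fock_norm psi g -> inner f f = inner g g.
Proof.
move=> ff fg E; apply: complex_eq; last by rewrite !(Im_inner hpsi).
by rewrite -!sqr_fock_norm E.
Qed.

Lemma unitary_coisometry (C : 'M[K]_n) (u : K) : C \is unitarymx -> u * u^* = 1 ->
  coisometry psi (weighted_comp (fun=> u) (fun z : Cn => C *m z)).
Proof.
move=> uC uu; have CD := unitarymxP uC.
have [D uD CD1] : exists2 D : 'M[K]_n, D \is unitarymx & C *m D = 1%:M.
  by exists (C ^t*); [rewrite trmxC_unitary|exact: CD].
have DC := mulmx1C CD1.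
have nD z : sqnorm (D *m z) = sqnorm z by exact: sqnorm_unitary.
have nC z : sqnorm (C *m z) = sqnorm z by exact: sqnorm_unitary.
pose T := weighted_comp (fun=> u^*) (fun z : Cn => D *m z).
have fD f : fock psi f -> fock psi (fun z => f (D *m z)) by exact: fock_act DC nD.
have Tfock f : fock psi f -> fock psi (T f).
  by move=> ff; apply: (fockZ hpsi); exact: fD.
have isoT : Defs.isometry psi T.
  move=> f ff; apply: fock_norm_eq; rewrite /T /weighted_comp.
  have fDf := fD f ff; have fTf := fockZ hpsi u^* fDf.
  rewrite (innerZl hpsi u^* fDf fTf).
  rewrite (innerZr hpsi u^* fDf fDf) conjCK mulrA [_ * u]mulrC uu mul1r.
  by have [hf _] := ff; exact: (inner_act hpsi DC nD).
exists T => //; split.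
  split=> // [a f g ff fg|].
    by apply/funext => z; rewrite /T /weighted_comp; ring.
  by exists 1 => f ff; rewrite mul1r isoT.
move=> f g ff fg; have [hf _] := ff; have [hg _] := fg.
have fC : fock psi (fun z => f (C *m z)) by exact: fock_act CD1 nC _.
rewrite /T /weighted_comp (innerZl hpsi u fC fg).
rewrite (innerZr hpsi u^* ff (fD g fg)) conjCK.
congr (_ * _).
rewrite -(inner_act hpsi CD1 nC hf (holomorphic_mulmx D hg)).
by congr fock_inner; apply/funext => z; rewrite mulmxA DC mul1mx.
Qed.


Variables (U : Cn -> K) (C : 'M[K]_n).
Local Notation S := (weighted_comp U (fun z : Cn => C *m z)).
Hypothesis bS : bounded_operator psi S.
Variable T : (Cn -> K) -> (Cn -> K).
Hypothesis adjT : is_adjoint psi S T.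
Hypothesis isoT : Defs.isometry psi T.

Local Notation one := (fun _ : Cn => 1 : K).
Let f1 : fock psi one. Proof. exact: fock_cst. Qed.

Let fS f : fock psi f -> fock psi (S f). Proof. by have [+ _ _] := bS; apply. Qed.
Let fT f : fock psi f -> fock psi (T f). Proof. by have [[+ _ _] _] := adjT; apply. Qed.
Let adj f g : fock psi f -> fock psi g -> inner (S f) g = inner f (T g).
Proof. by have [_ +] := adjT; apply. Qed.
Let TT f : fock psi f -> inner (T f) (T f) = inner f f.
Proof. by move=> ff; apply: inner_eq_norm; [exact: fT|by []|exact: isoT]. Qed.

Lemma inner_sub_sub f g : fock psi f -> fock psi g ->
  inner (fun z => f z - g z) (fun z => f z - g z) =
  inner f f - inner f g - (inner g f - inner g g).
Proof.
move=> ff fg; rewrite (innerBl hpsi ff fg (fockB hpsi ff fg)).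
by rewrite (innerBr hpsi ff fg ff) (innerBr hpsi ff fg fg).
Qed.

Lemma inner_sub0 f g : fock psi f -> fock psi g ->
  complex.Re (inner (fun z => f z - g z) (fun z => f z - g z)) <= 0 -> f =1 g.
Proof.
move=> ff fg le0 z; apply/eqP; rewrite -subr_eq0; apply/eqP.
apply: (inner_definite hpsi (f := fun z => f z - g z)); first exact: fockB.
by apply/le_anti; rewrite le0 Re_inner_ge0.
Qed.

Let m := inner one one.

Let m_neq0 : m != 0.
Proof.
apply/eqP => m0; have /(_ 0)/eqP := inner_definite hpsi f1 (congr1 (@complex.Re R) m0).
by rewrite oner_eq0.
Qed.

(** [<f, T 1> = <S f, 1> = U 0 * f 0 * m = <f, (U 0)^*>] for every [f]: the inner
    product with [1] is [m] times evaluation at [0]. *)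
Let T1 z : T one z = (U 0)^*.
Proof.
pose c z : K := (U 0)^* * one z.
have fc : fock psi c by exact: fockZ.
suff /(_ z) : T one =1 c by rewrite /c mulr1.
have E f : fock psi f -> inner f (T one) = inner f c.
  move=> ff; rewrite -adj// (mean_value hpsi (fS ff)) (innerZr hpsi)// conjCK.
  by rewrite (mean_value hpsi ff) /weighted_comp mulmx0 mulrA.
apply: inner_sub0 => //; first exact: fT.
have fh : fock psi (fun z => T one z - c z) by apply: fockB => //; exact: fT.
by rewrite (innerBr hpsi) ?E ?subrr//; exact: fT.
Qed.

Let U0 : U 0 * (U 0)^* = 1.
Proof.
have Tc : T one = (fun z => (U 0)^* * one z) by apply/funext => z; rewrite T1 mulr1.
have fc := fockZ hpsi (U 0)^* f1.
have := TT f1; rewrite Tc (innerZl hpsi (U 0)^* f1 fc).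
rewrite (innerZr hpsi (U 0)^* f1 f1) conjCK mulrA => /(canRL (mulfK m_neq0)).
by rewrite divff// mulrC.
Qed.

(** [0 <= |f - T S f|^2 = |f|^2 - 2 |S f|^2 + |T S f|^2], and [T] is an
    isometry. *)
Let S_contraction f : fock psi f ->
  complex.Re (inner (S f) (S f)) <= complex.Re (inner f f).
Proof.
move=> ff; have fSf := fS ff; have fTS := fT fSf.
have := Re_inner_ge0 psi (fun z => f z - T (S f) z).
rewrite (inner_sub_sub ff fTS) (TT fSf) -(adj ff fSf) (innerC hpsi ff fTS) -(adj ff fSf).
by rewrite !ReB ReC; lra.
Qed.

(** [|S T f - f|^2 = |S T f|^2 - 2 |T f|^2 + |f|^2 <= |T f|^2 - 2 |T f|^2 + |f|^2],
    which is zero. *)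
Let STK f : fock psi f -> S (T f) =1 f.
Proof.
move=> ff; have fTf := fT ff; have fST := fS fTf.
apply: inner_sub0 => //; rewrite (inner_sub_sub fST ff).
rewrite (innerC hpsi fST ff) (adj fTf ff) (TT ff) !ReB ReC.
by have := S_contraction fTf; rewrite (TT ff); lra.
Qed.

Let Uc z : U z * (U 0)^* = 1.
Proof. by have := STK f1 z; rewrite /weighted_comp T1. Qed.

Lemma coisometry_weight z : U z = ((U 0)^*)^-1 /\ `|U z| = 1.
Proof.
have E w : U w = ((U 0)^*)^-1.
  have c0 : (U 0)^* != 0.
    by apply/eqP => c0; have /eqP := Uc 0; rewrite c0 mulr0 eq_sym oner_eq0.
  by rewrite -[LHS](mulfK c0) Uc mul1r.
split; first exact: E.
have /eqP : `|U 0| ^+ 2 = 1 by rewrite normCK.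
by rewrite (E z) -(E 0) sqrp_eq1// => /eqP.
Qed.

Let UE z : U z = U 0.
Proof. by rewrite (coisometry_weight z).1 -(coisometry_weight 0).1. Qed.

Let U_neq0 z : U z != 0.
Proof. by apply/eqP => U0'; have /eqP := Uc z; rewrite U0' mul0r eq_sym oner_eq0. Qed.

(** If [C v = 0], the identity [S T f = f] gives [f v = U v * T f 0 = U 0 * T f 0 =
    f 0] for each coordinate [f]. *)
Let C_inj (v : Cn) : C *m v = 0 -> v = 0.
Proof.
move=> Cv; apply/colP => j.
rewrite -(STK (fock_coord hpsi j) v) -[RHS](STK (fock_coord hpsi j) 0).
by rewrite /weighted_comp Cv mulmx0 UE.
Qed.

Let C_unit : C \in unitmx.
Proof.
rewrite -unitmx_tr -row_free_unit -kermx_eq0; apply/eqP/row_matrixP => i.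
rewrite row0; apply: trmx_inj; rewrite trmx0; apply: C_inj.
have := congr1 (fun A => (row i A)^T) (mulmx_ker C^T).
by rewrite row_mul trmx_mul trmxK row0 trmx0.
Qed.

(** [S] is injective because [U] has no zero and [C] is onto. *)
Let TSK f : fock psi f -> T (S f) = f.
Proof.
move=> ff; apply/funext => y; rewrite -[y]mul1mx -(mulmxV C_unit) -mulmxA.
by apply: (mulfI (U_neq0 (invmx C *m y))); exact: (STK (fS ff)).
Qed.

Let coord (j : 'I_n) (z : Cn) : K := z j 0.
Let linear_form (a : 'I_n -> K) (z : Cn) : K := \sum_l a l * z l 0.

Let fock_sum (s : seq 'I_n) (a : 'I_n -> K) :
  fock psi (fun z : Cn => \sum_(l <- s) a l * z l 0).
Proof.
elim: s => [|l s IH].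
  have -> : (fun z : Cn => \sum_(l <- [::]) a l * z l 0) = (fun=> 0).
    by apply/funext => z; rewrite big_nil.
  exact: fock_cst.
have -> : (fun z : Cn => \sum_(l <- l :: s) a l * z l 0) =
    (fun z => a l * z l 0 + \sum_(l <- s) a l * z l 0).
  by apply/funext => z; rewrite big_cons.
by apply: (fockZD hpsi) => //; exact: fock_coord.
Qed.

Let fock_linear a : fock psi (linear_form a). Proof. exact: fock_sum. Qed.

Let inner_linearl a g : fock psi g ->
  inner (linear_form a) g = \sum_l a l * inner (coord l) g.
Proof.
move=> fg; rewrite /linear_form; elim: (index_enum _) => [|l s IH].
  rewrite big_nil (_ : (fun z : Cn => _) = (fun z => 0 * one z)); last first.
    by apply/funext => z; rewrite big_nil mul0r.
  by rewrite (innerZl hpsi)// mul0r.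
have fl : fock psi (coord l) by exact: fock_coord.
rewrite big_cons -IH -(innerZl hpsi (a l) fl fg).
rewrite -(innerDl hpsi (fockZ hpsi (a l) fl) (fock_sum s a) fg).
have -> : (fun z : Cn => \sum_(l <- l :: s) a l * z l 0) =
    (fun z => a l * coord l z + \sum_(l <- s) a l * z l 0).
  by apply/funext => z; rewrite big_cons.
by [].
Qed.

Let inner_coord_linear k b : inner (coord k) (linear_form b) =
  (b k)^* * inner (coord k) (coord k).
Proof.
rewrite (innerC hpsi (fock_linear b) (fock_coord hpsi k)).
rewrite inner_linearl; last exact: fock_coord.
rewrite rmorph_sum (bigD1 k)//= big1 ?addr0.
  by rewrite rmorphM/= -(innerC hpsi); try exact: fock_coord.
move=> l lk; rewrite /coord (inner_coord hpsi) (negPf lk) mul0r mulr0.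
exact: rmorph0.
Qed.

(** [<S z_j, S z_k> = <z_j, T S z_k> = <z_j, z_k>], and up to the common squared
    norm of the coordinates the left-hand side is the inner product of the rows
    [j] and [k] of [C]. *)
Lemma coisometry_unitary : C \is unitarymx.
Proof.
apply/unitarymxP/matrixP => j k.
have Scoord i : S (coord i) = (fun z => U 0 * linear_form (C i) z).
  by apply/funext => z; rewrite /weighted_comp UE /coord mxE.
have fj i : fock psi (coord i) by exact: fock_coord.
have kap0 : inner (coord j) (coord j) != 0.
  apply/eqP => k0.
  have /(_ (delta_mx j 0)) := inner_definite hpsi (fj j) (congr1 (@complex.Re R) k0).
  by rewrite /coord mxE !eqxx => /eqP; rewrite oner_eq0.
apply: (mulIf kap0).
have : inner (S (coord j)) (S (coord k)) = inner (coord j) (coord k).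
  by rewrite (adj (fj j) (fS (fj k))) (TSK (fj k)).
rewrite (inner_coord hpsi j k) !Scoord (innerZl hpsi)//; last exact: fockZ.
rewrite (innerZr hpsi)// mulrA U0 mul1r => E.
rewrite [in RHS]mxE -E inner_linearl// mxE mulr_suml; apply: eq_bigr => l _.
rewrite inner_coord_linear -mulrA !mxE; congr (_ * (_ * _)).
exact: inner_coord_diag.
Qed.

End UnitaryOperator.

Theorem lemma3p3 (R : realType) (n : nat) (hn : (1 <= n)%N) (psi : R -> R)
    (hpsi : admissible_weight n psi)
    (C : 'M[R[i]]_n) (hC : opnorm C <= 1)
    (U : 'cV[R[i]]_n -> R[i]) (hU : holomorphic U)
    (hbounded : bounded_operator psi (weighted_comp U (fun z => C *m z))) :
  coisometry psi (weighted_comp U (fun z => C *m z)) <->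
  (forall z, U z = ((U 0)^*)^-1 /\ `|U z| = 1) /\ C \is unitarymx.
Proof.
split=> [[T adjT isoT]|[UE uC]].
  split; last exact: (coisometry_unitary hpsi hbounded adjT isoT).
  by move=> z; exact: (coisometry_weight hpsi hbounded adjT isoT).
have UU : U = (fun=> U 0) by apply/funext => z; rewrite (UE z).1 -(UE 0).1.
have uu : U 0 * (U 0)^* = 1 by rewrite -normCK (UE 0).2 expr1n.
by rewrite UU; exact: unitary_coisometry.
Qed.
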